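(* Consider the following two assertions. (B'$_{Rel}$) For every $n\ge 1$, all reduced complex analytic function germs $f,g\colon(\mathbb{C}^n,0)\to(\mathbb{C},0)$ and every germ of homeomorphism $\varphi\colon(\mathbb{C}^n,0)\to(\mathbb{C}^n,0)$ with $f=g\circ\varphi$: let $X_1,\dots,X_r$ be the irreducible components of $C(V(f),0)$ and $Y_1,\dots,Y_s$ the irreducible components of $C(V(g),0)$; if at least one of $C(V(f),0)$, $C(V(g),0)$ is a linear subspace of $\mathbb{C}^n$, then $r=s=1$ and $k_{V(f)}(X_1)=k_{V(g)}(Y_1)$. (A') For every $n\ge 1$, all reduced complex analytic function germs $f,g\colon(\mathbb{C}^n,0)\to(\mathbb{C},0)$ and every germ of homeomorphism $\varphi\colon(\mathbb{C}^n,0)\to(\mathbb{C}^n,0)$ with $f=g\circ\varphi$, one has $m(V(f),0)=m(V(g),0)$. If (B'$_{Rel}$) is true, then (A') is true.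
   Context: $V(f)$ denotes the zero set (germ) of $f$. For a reduced holomorphic germ $f\colon(\mathbb{C}^n,0)\to(\mathbb{C},0)$ (in particular not identically zero, without repeated irreducible factors), write $f=f_m+f_{m+1}+\cdots$ with $f_k$ homogeneous of degree $k$ and $f_m\neq 0$. The multiplicity of $V(f)$ at $0$ is $m(V(f),0):=m$, and the tangent cone of $V(f)$ at $0$ is $C(V(f),0)=V(f_m)\subset\mathbb{C}^n$. Decompose $f_m=h_1^{k_1}\cdots h_r^{k_r}$ into powers of pairwise non-associate irreducible polynomials $h_i$. The irreducible components of $C(V(f),0)$ are the $V(h_i)$, and the relative multiplicity of $V(f)$ along $V(h_i)$ is $k_{V(f)}(V(h_i)):=k_i$. *)

(* Defs.v *)
From HB Require Import structures.
From mathcomp Require Import all_boot all_order all_algebra.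
From mathcomp Require Import complex.
From mathcomp Require Import all_classical all_reals all_analysis.
(* The notations of mpoly are incompatible with those of MathComp-Analysis. *)
From mathcomp Require Import -(notations) mpoly.

Set Implicit Arguments.
Unset Strict Implicit.
Unset Printing Implicit Defensive.

Import Order.TTheory GRing.Theory Num.Theory.
Import numFieldNormedType.Exports.

Local Open Scope classical_set_scope.
Local Open Scope ring_scope.

(* Everything is written for K : numClosedFieldType, which carries its norm
   topology, and is meant for K = R[i] with R : realType: R[i] is canonically a
   numClosedFieldType, but has no direct topological instance.  A germ at the
   origin is represented by a total function, of which only the values near 0
   matter. *)

Section Germs.
Context {K : numClosedFieldType} {n : nat}.
Implicit Types (f g p q u v : 'rV[K]_n -> K) (P : nat -> mpoly n K).

Definition germ_eq f g : Prop := \forall x \near (0 : 'rV[K]_n), f x = g x.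

Definition eval_at (x : 'rV[K]_n) (p : mpoly n K) : K :=
  meval (fun i => x 0 i) p.

(* sum of the absolute values of the monomials of p at x *)
Definition abs_eval_at (x : 'rV[K]_n) (p : mpoly n K) : K :=
  \sum_(a <- msupp p) `|mcoeff a p * \prod_(i < n) x 0 i ^+ a i|.

(* f = P_0 + P_1 + ... near 0 with P_k homogeneous of degree k; absolute
   convergence is required of the whole family of monomials, so this is the
   expansion of f as a convergent power series in n variables, grouped by
   degree. *)
Definition power_series_expansion f P : Prop :=
  (forall k, P k \is ishomog1 k mdeg) /\
  \forall x \near (0 : 'rV[K]_n),
    cvgn (series (fun k => abs_eval_at x (P k))) /\
    series (fun k => eval_at x (P k)) @ \oo --> f x.

Definition analytic_germ f : Prop := exists P, power_series_expansion f P.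

Definition unit_germ u : Prop :=
  analytic_germ u /\
  exists2 v, analytic_germ v & germ_eq (fun x => u x * v x) (fun=> 1).

Definition irreducible_germ p : Prop :=
  [/\ analytic_germ p, ~ germ_eq p (fun=> 0), ~ unit_germ p &
      forall u v, analytic_germ u -> analytic_germ v ->
        germ_eq p (fun x => u x * v x) -> unit_germ u \/ unit_germ v].

Definition reduced_germ f : Prop :=
  [/\ analytic_germ f, f 0 = 0, ~ germ_eq f (fun=> 0) &
      forall p, irreducible_germ p ->
        ~ exists2 q, analytic_germ q & germ_eq f (fun x => p x ^+ 2 * q x)].

(* The expansion of an analytic germ is unique; xget picks it, and the default
   value only matters for germs that are not analytic. *)
Definition homogeneous_part f : nat -> mpoly n K :=
  xget (fun=> 0) [set P | power_series_expansion f P].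

Definition multiplicity f : nat :=
  xget 0%N [set m | homogeneous_part f m <> 0 /\
                    forall k, (k < m)%N -> homogeneous_part f k = 0].

Definition initial_form f : mpoly n K := homogeneous_part f (multiplicity f).

Definition zero_locus (p : mpoly n K) : set 'rV[K]_n :=
  [set x | eval_at x p = 0].

Definition tangent_cone f : set 'rV[K]_n := zero_locus (initial_form f).

Definition linear_subspace (A : set 'rV[K]_n) : Prop :=
  exists W : {vspace 'rV[K]_n}, A = [set x | x \in W].

Definition algebraic_set (A : set 'rV[K]_n) : Prop :=
  exists I : set (mpoly n K), A = \bigcap_(p in I) zero_locus p.

Definition irreducible_algebraic_set (A : set 'rV[K]_n) : Prop :=
  [/\ algebraic_set A, A !=set0 &
      forall B1 B2, algebraic_set B1 -> algebraic_set B2 ->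
        A = B1 `|` B2 -> A = B1 \/ A = B2].

Definition irreducible_components (A : set 'rV[K]_n) : set (set 'rV[K]_n) :=
  [set X | [/\ irreducible_algebraic_set X, X `<=` A &
      forall Z, irreducible_algebraic_set Z -> X `<=` Z -> Z `<=` A -> Z = X]].

Definition irreducible_mpoly (h : mpoly n K) : Prop :=
  [/\ h <> 0, h \isn't a GRing.unit &
      forall a b, h = a * b -> a \is a GRing.unit \/ b \is a GRing.unit].

Definition associate_mpoly (h h' : mpoly n K) : Prop :=
  exists2 u, u \is a GRing.unit & h = u * h'.

Definition irreducible_factorization (p : mpoly n K) (r : nat)
    (h : 'I_r -> mpoly n K) (e : 'I_r -> nat) : Prop :=
  [/\ forall i, irreducible_mpoly (h i),
      forall i j, i != j -> ~ associate_mpoly (h i) (h j),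
      forall i, (0 < e i)%N &
      p = \prod_(i < r) h i ^+ e i].

(* Relative multiplicity of V(f) along X; the default value 0 only occurs if X
   is not an irreducible component of the tangent cone of V(f). *)
Definition relative_multiplicity f (X : set 'rV[K]_n) : nat :=
  xget 0%N [set k | exists r (h : 'I_r -> mpoly n K) (e : 'I_r -> nat) i,
    [/\ irreducible_factorization (initial_form f) h e,
        X = zero_locus (h i) & k = e i]].

Definition homeomorphism_germ (phi : 'rV[K]_n -> 'rV[K]_n) : Prop :=
  phi 0 = 0 /\
  exists (U V : set 'rV[K]_n) (psi : 'rV[K]_n -> 'rV[K]_n),
    [/\ open_nbhs (0 : 'rV[K]_n) U, open_nbhs (0 : 'rV[K]_n) V,
        {within U, continuous phi} /\ {within V, continuous psi},
        (forall x, U x -> V (phi x) /\ psi (phi x) = x) &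
        (forall y, V y -> U (psi y) /\ phi (psi y) = y)].

End Germs.

(* Main.v *)
Require Import Defs.
From HB Require Import structures.
From mathcomp Require Import all_boot all_order all_algebra.
From mathcomp Require Import complex.
From mathcomp Require Import all_classical all_reals all_analysis.
From mathcomp Require Import -(notations) mpoly.
From mathcomp Require Import ring.
From mathcomp Require ssrcomplements.

Set Implicit Arguments.
Unset Strict Implicit.
Unset Printing Implicit Defensive.

Import Order.TTheory GRing.Theory Num.Theory.
Import numFieldNormedType.Exports.

Local Open Scope classical_set_scope.
Local Open Scope ring_scope.

(* Suspend: F(x,z) = f(x)^2 + z^b and G(x,z) = g(x)^2 + z^b are reduced germs on
   C^(n+1), conjugated by phi x id.  If m(f) < m(g), take b = 2 m(f) + 1, which
   is less than 2 m(g).  Then the initial form of G is z^b: its tangent cone is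
   the hyperplane z = 0, along which the relative multiplicity is b.  The
   initial form of F has degree 2 m(f) < b, so none of its relative
   multiplicities can equal b, against (B'_Rel).

   F is reduced: if p^2 divides F then p divides dF/dz = b z^(b-1), while z does
   not divide p because F(x,0) = f(x)^2 is not 0; dividing by z repeatedly, p
   divides a nonzero constant among formal power series, so p(0) <> 0 and p is
   a unit. *)

(** * Formal power series *)

(** Squaring f and g makes room for the exponent: if m(f) and m(g) differ, 2 m(f) and 2 m(g) differ
    by at least 2, so an integer b fits strictly between them even when m(g) = m(f) + 1. The price
    is that f^2 is not reduced, and the added z^b must be shown to remove every square factor; most
    of the work goes there. The extra variable is why (B'_Rel) is assumed in all dimensions at once.

    The divisibility argument is purely formal. A series is the sequence of its homogeneous parts,
    each read as a polynomial in z over K[x], so d/dz acts term by term and the quotients by z carry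
    no convergence condition. Only p(0) <> 0 comes back to germs. Convergence then matters for sums,
    products and the reciprocal of p, and is controlled by geometric bounds on coefficients. *)

Section CauchyProduct.
Context {A : comNzRingType}.
Implicit Types P Q S : nat -> A.

Definition cauchy_prod P Q (k : nat) : A :=
  \sum_(i < k.+1) P i * Q (k - i)%N.

(** Truncation at any order above k leaves the k-th coefficient unchanged, so ring identities for
    series are inherited from [{poly A}]. *)
Lemma cauchy_prod_coef P Q N k : (k < N)%N ->
  cauchy_prod P Q k = ((\poly_(i < N) P i) * (\poly_(i < N) Q i))`_k.
Proof.
move=> kN; rewrite coefM; apply: eq_bigr => i _.
by rewrite !coef_poly (leq_ltn_trans _ kN) ?(leq_ltn_trans (leq_subr _ _) kN)
  // -ltnS.
Qed.

Lemma cauchy_prod_poly P (q : {poly A}) N k : (k < N)%N ->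
  cauchy_prod P (fun i => q`_i) k = ((\poly_(i < N) P i) * q)`_k.
Proof.
move=> kN; rewrite coefM; apply: eq_bigr => i _.
by rewrite !coef_poly (leq_ltn_trans _ kN) // -ltnS.
Qed.

Lemma eq_cauchy_prod P P' Q Q' k :
  (forall i, (i <= k)%N -> P i = P' i) -> (forall i, (i <= k)%N -> Q i = Q' i) ->
  cauchy_prod P Q k = cauchy_prod P' Q' k.
Proof.
move=> eP eQ; apply: eq_bigr => i _.
by rewrite eP ?eQ ?leq_subr // -ltnS.
Qed.

Lemma cauchy_prodCA P Q S k :
  cauchy_prod P (cauchy_prod Q S) k = cauchy_prod Q (cauchy_prod P S) k.
Proof.
have E P1 Q1 : cauchy_prod P1 (cauchy_prod Q1 S) k =
    ((\poly_(i < k.+1) P1 i) * ((\poly_(i < k.+1) Q1 i) *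
     (\poly_(i < k.+1) S i)))`_k.
  rewrite -cauchy_prod_poly //; apply: eq_cauchy_prod => // i ik.
  exact: cauchy_prod_coef.
by rewrite !E mulrCA.
Qed.

Lemma cauchy_prodDr P Q S k :
  cauchy_prod P (fun i => Q i + S i) k = cauchy_prod P Q k + cauchy_prod P S k.
Proof. by rewrite -big_split; apply: eq_bigr => i _; rewrite mulrDr. Qed.

Lemma cauchy_prod_eq0 P Q i j k : (forall l, (l < i)%N -> P l = 0) ->
  (forall l, (l < j)%N -> Q l = 0) -> (k < i + j)%N -> cauchy_prod P Q k = 0.
Proof.
move=> P0 Q0 kij; apply: big1 => l _.
have [li|il] := ltnP l i; first by rewrite P0 ?mul0r.
have lk : (l <= k)%N by rewrite -ltnS.
by rewrite Q0 ?mulr0 // ltn_subLR // (leq_trans kij) ?leq_add2r.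
Qed.

Lemma cauchy_prod_lead P Q i j : (forall l, (l < i)%N -> P l = 0) ->
  (forall l, (l < j)%N -> Q l = 0) -> cauchy_prod P Q (i + j) = P i * Q j.
Proof.
move=> P0 Q0; have il : (i < (i + j).+1)%N by rewrite ltnS leq_addr.
rewrite /cauchy_prod (bigD1 (Ordinal il)) //= addKn big1 ?addr0 // => l.
rewrite -val_eqE /= neq_ltn => /orP[li|il']; first by rewrite P0 ?mul0r.
have lij : (l <= i + j)%N by rewrite -ltnS.
by rewrite Q0 ?mulr0 // ltn_subLR // ltn_add2r.
Qed.

End CauchyProduct.

Lemma lowest_index (V : nmodType) (P : nat -> V) k : P k != 0 ->
  exists2 i, P i != 0 & forall l, (l < i)%N -> P l = 0.
Proof.
move=> Pk; have exP : exists k, P k != 0 by exists k.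
case: (ex_minnP exP) => i Pi imin; exists i => // l li.
by apply/eqP/negPn/negP => /imin; rewrite leqNgt li.
Qed.

(** * Square divisors of a series of the form H(x) + z^b *)

Section SquareFree.
Context {B : idomainType}.
Implicit Types (P Q W : nat -> {poly B}) (H : nat -> B).

(** The variable z = ['X] is prime among series: modulo z the coefficients lie in the domain [B],
    where the lowest nonzero terms of P and W would have a nonzero product. Since P is nonzero
    modulo z and the product vanishes there, z divides W and can be cancelled, l times in all. *)
Lemma cauchy_prod_divX P W b l (c : B) :
  (exists i, (P i)`_0 != 0) ->
  cauchy_prod P W =1 (fun k => if k == b then c%:P * 'X^l else 0) ->
  exists W', cauchy_prod P W' =1 (fun k => if k == b then c%:P else 0).
Proof.
move=> [i0 Pi0]; elim: l W => [|l IH] W PW.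
  by exists W => k; rewrite PW mulr1.
have W0 k : (W k)`_0 = 0.
  apply/eqP/negPn/negP => Wk.
  have [i Pi iP] := @lowest_index _ (fun i => (P i)`_0) _ Pi0.
  have [j Wj jW] := @lowest_index _ (fun i => (W i)`_0) _ Wk.
  have := cauchy_prod_lead iP jW.
  rewrite [LHS](_ : _ = (cauchy_prod P W (i + j))`_0); last first.
    by rewrite coef_sum; apply: eq_bigr => k' _; rewrite coef0M.
  rewrite PW; move=> /esym/eqP; case: ifP => _.
    by rewrite exprS mulrCA coefXM eqxx mulf_eq0 (negbTE Pi) (negbTE Wj).
  by rewrite coef0 mulf_eq0 (negbTE Pi) (negbTE Wj).
apply: (IH (fun k => drop_poly 1 (W k))) => k.
have X0 : 'X != 0 :> {poly B} by rewrite polyX_eq0.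
apply: (mulIf X0).
transitivity (cauchy_prod P W k).
  rewrite /cauchy_prod big_distrl; apply: eq_bigr => i _ /=.
  rewrite -mulrA; congr (_ * _).
  rewrite -[RHS](poly_take_drop 1) expr1 -[LHS]add0r; congr (_ + _).
  by apply/polyP => -[|m]; rewrite coef_take_poly coef0 //= W0.
by rewrite PW; case: ifP; rewrite ?mul0r // -mulrA -exprSr.
Qed.

(** P divides the z-derivative of P^2 Q, in which H disappears because it is free of z. After
    division by powers of z, P divides the constant b placed at index b, and lowest terms are
    compared. *)
Lemma cauchy_sqr_lead_unit P Q H b :
  (0 < b)%N -> b%:R != 0 :> B -> (exists k, H k != 0) ->
  cauchy_prod P (cauchy_prod P Q) =1
    (fun k => (H k)%:P + (if k == b then 'X^b else 0)) ->
  exists i w, (forall k, (k < i)%N -> P k = 0) /\ P i * w = (b%:R)%:P.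
Proof.
move=> b_gt0 bB [k0 Hk0] PPQ.
(* At z = 0 the right-hand side becomes H, since b > 0; if z divided every part of P, then H would
   vanish. *)
have [i1 Pi1] : exists i, (P i)`_0 != 0.
  have : [exists i : 'I_k0.+1, (P i)`_0 != 0].
    apply: contraNT Hk0 => /existsPn Pn0.
    have /(congr1 (coefp 0)) := PPQ k0.
    rewrite /= coefD coefC /= [X in _ + X](_ : _ = 0) ?addr0 => [<-|].
      rewrite coef_sum big1 // => i _; rewrite coef0M.
      by move/negPn: (Pn0 i) => /eqP ->; rewrite mul0r.
    by case: ifP => // _; rewrite ?coef0 // coefXn eq_sym eqn0Ngt b_gt0.
  by case/existsP => i ?; exists i.
(* W is 2 P' Q + P Q', the cofactor of P in (P^2 Q)'. Indices are not shifted by the derivative, so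
   z^b at index b becomes b z^(b-1) at the same index. *)
pose W k := cauchy_prod (fun i => (P i)^`()) Q k +
  (cauchy_prod (fun i => (P i)^`()) Q k + cauchy_prod P (fun i => (Q i)^`()) k).
have PW : cauchy_prod P W =1
    (fun k => if k == b then (b%:R)%:P * 'X^(b.-1) else 0).
  move=> k; have /(congr1 (@deriv _)) := PPQ k.
  rewrite derivD derivC add0r.
  have -> : deriv (if k == b then 'X^b : {poly B} else 0) =
      (if k == b then (b%:R)%:P * 'X^(b.-1) else 0).
    by case: ifP; rewrite ?deriv0 // derivXn mul_polyC -scaler_nat.
  move=> <-; rewrite /W cauchy_prodDr.
  have derivCP (S T : nat -> {poly B}) m : (cauchy_prod S T m)^`() =
      cauchy_prod (fun i => (S i)^`()) T m + cauchy_prod S (fun i => (T i)^`()) m.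
    by rewrite raddf_sum -big_split; apply: eq_bigr => i _ /=; rewrite derivM.
  rewrite derivCP cauchy_prodCA; congr (_ + _).
  by apply: eq_bigr => i _; rewrite derivCP.
have [W' PW'] := cauchy_prod_divX (ex_intro _ i1 Pi1) PW.
have Pi1n0 : P i1 != 0 by apply: contraNneq Pi1 => ->; rewrite coef0.
have [i Pi iP] := lowest_index Pi1n0.
have [j Wj jW] : exists2 j, W' j != 0 & forall l, (l < j)%N -> W' l = 0.
  have : [exists j : 'I_b.+1, W' j != 0].
    have := PW' b; rewrite eqxx => /eqP; apply: contraLR => /existsPn W0.
    rewrite /cauchy_prod big1 ?(eq_sym 0) ?polyC_eq0 // => l _.
    have lb : (b - l < b.+1)%N by rewrite ltnS leq_subr.
    by have /negPn/eqP /= -> := W0 (Ordinal lb); rewrite mulr0.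
  by case/existsP => j; exact: lowest_index.
exists i, (W' j); split => //.
(* The product of the lowest terms is nonzero, so its index i + j must be b, the only index where
   the right-hand side survives. *)
have := cauchy_prod_lead iP jW; rewrite PW'; case: ifP => // _ /esym/eqP.
by rewrite mulf_eq0 (negbTE Pi) (negbTE Wj).
Qed.

End SquareFree.

Lemma polyC_addXn_neq0 (R : nzRingType) (c : R) b : (0 < b)%N ->
  c%:P + 'X^b != 0.
Proof.
move=> b0; apply/eqP => /polyP/(_ b)/eqP.
by rewrite coefD coefC (gtn_eqF b0) coefXn eqxx coef0 add0r oner_eq0.
Qed.

(** * Polynomials in n+1 variables as polynomials in the last one *)

Section LastVariable.
Context {n : nat}.
Local Notation widen := (widen_ord (leqnSn n)).

Definition mnm_rcons (m : multinom n) (j : nat) : multinom n.+1 :=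
  Multinom [tuple of rcons m j].

Lemma mnm_rcons_widen m j i : mnm_rcons m j (widen i) = m i.
Proof.
rewrite multinomE (tnth_nth 0%N) /= nth_rcons size_tuple ltn_ord.
by rewrite (mnm_nth 0%N).
Qed.

Lemma mnm_rcons_max m j : mnm_rcons m j ord_max = j.
Proof.
by rewrite multinomE (tnth_nth 0%N) /= nth_rcons size_tuple ltnn eqxx.
Qed.

Lemma widen_lift (i : 'I_n) : widen i = lift ord_max i.
Proof. by apply/val_inj; rewrite /= /bump leqNgt ltn_ord. Qed.

Lemma ord_widenP (P : 'I_n.+1 -> Prop) :
  (forall i, P (widen i)) -> P ord_max -> forall i, P i.
Proof.
move=> Pw Pm i; case: (unliftP ord_max i) => [i' ->|-> //].
by rewrite -widen_lift.
Qed.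

Lemma mnm_rconsP (m : multinom n.+1) m' j :
  (m == mnm_rcons m' j) =
  (j == m ord_max) && (Multinom [tuple m (widen i) | i < n] == m').
Proof.
apply/eqP/andP => [->|[/eqP -> /eqP <-]].
  by rewrite mnm_rcons_max; split => //; apply/eqP/mnmP => i;
    rewrite mnmE mnm_rcons_widen.
apply/mnmP; apply: ord_widenP => [i|]; last by rewrite mnm_rcons_max.
by rewrite mnm_rcons_widen mnmE.
Qed.

Lemma coef_muni (R : nzRingType) (p : mpoly n.+1 R) j (m : multinom n) :
  mcoeff m (muni p)`_j = mcoeff (mnm_rcons m j) p.
Proof.
rewrite muniE coef_sum raddf_sum /= [in RHS](mpolyE p) raddf_sum /=.
apply: eq_bigr => m' _; rewrite coefZ coefXn mcoeffZ mcoeffX mnm_rconsP.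
by case: eqP => _; rewrite /= ?mulr0 ?mcoeff0 ?mulr1 // mcoeffZ mcoeffX.
Qed.

Lemma muni_inj (R : nzRingType) : injective (@muni n R).
Proof.
move=> p q pq; apply/mpolyP => m.
suff -> : m = mnm_rcons (Multinom [tuple m (widen i) | i < n]) (m ord_max).
  by rewrite -!coef_muni pq.
by apply/eqP; rewrite mnm_rconsP !eqxx.
Qed.

Lemma muni_mwiden (R : nzRingType) (p : mpoly n R) : muni (mwiden p) = p%:P.
Proof.
(* The difference of the two sides is additive in q, so it suffices to check monomials. *)
pose g (q : mpoly n R) := muni (mwiden q) - q%:P.
have gD : {morph g : q1 q2 / q1 + q2}.
  by move=> q1 q2; rewrite /g mwidenD muniD polyCD opprD addrACA.
have g0 : g 0 = 0 by rewrite /g mwiden0 muni0 polyC0 subrr.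
apply/eqP; rewrite -subr_eq0; apply/eqP; rewrite -/(g p) (mpolyE p).
rewrite (big_morph g gD g0); apply: big1 => m _.
apply/eqP; rewrite subr_eq0; apply/eqP.
rewrite mwidenZ mwidenX muniZ -mul_mpolyC polyCM -mul_polyC; congr (_ * _).
rewrite muniE msuppX big_seq1 mcoeffX eqxx scale1r mnmwiden_ordmax expr0.
rewrite alg_polyC; congr (_%:P); congr mpolyX.
by apply/mnmP => i; rewrite mnmE mnmwiden_widen.
Qed.

Lemma muniX (R : nzRingType) : muni (mpolyX R (mnm1 ord_max)) = 'X :> {poly mpoly n R}.
Proof.
rewrite muniE msuppX big_seq1 mcoeffX eqxx scale1r mnm1E eqxx expr1.
set m := Multinom _; have -> : m = mnm0; last by rewrite mpolyX0 scale1r.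
by apply/mnmP => i; rewrite mnmE mnm1E mnm0E -val_eqE /= gtn_eqF.
Qed.

Lemma muniXn (R : nzRingType) b :
  muni (mpolyX R (mnm1 ord_max) ^+ b) = 'X^b :> {poly mpoly n R}.
Proof. by elim: b => [|b IH]; rewrite ?muni1 // !exprS muniM muniX IH. Qed.

Lemma mwiden_addXn_neq0 (R : nzRingType) (q : mpoly n R) b : (0 < b)%N ->
  mwiden q + mpolyX R (mnm1 ord_max) ^+ b != 0.
Proof.
move=> b0; apply/eqP => /(congr1 (@muni _ _)) /eqP.
by rewrite muniD muni_mwiden muniXn muni0 (negbTE (polyC_addXn_neq0 _ b0)).
Qed.

Lemma meval_muni (R : comNzRingType) (x : 'I_n.+1 -> R) (p : mpoly n.+1 R) :
  meval x p = (map_poly (meval (fun i => x (widen i))) (muni p)).[x ord_max].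
Proof.
rewrite mevalE muniE !raddf_sum /= horner_sum; apply: eq_bigr => m _.
rewrite map_polyZ /= mevalZ mevalX map_polyXn hornerZ hornerXn -mulrA.
congr (_ * _); rewrite big_ord_recr /=; congr (_ * _).
by apply: eq_bigr => i _; rewrite mnmE.
Qed.

Lemma meval_mwiden (R : comNzRingType) (x : 'I_n.+1 -> R) (p : mpoly n R) :
  meval x (mwiden p) = meval (fun i => x (widen i)) p.
Proof. by rewrite meval_muni muni_mwiden map_polyC hornerC. Qed.

Lemma mwiden_homog (R : nzRingType) k (p : mpoly n R) :
  p \is ishomog1 k mdeg -> mwiden p \is ishomog1 k mdeg.
Proof.
move=> /dhomogP pk; rewrite (mpolyE p) raddf_sum /= big_seq.
apply: rpred_sum => m /pk mk; rewrite mwidenZ mwidenX.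
apply: dhomogZ; rewrite dhomogX /= mdegE big_ord_recr /= mnmwiden_ordmax addn0.
by rewrite -mk /= mdegE; apply/eqP/eq_bigr => i _; rewrite mnmwiden_widen.
Qed.

Lemma muni_cauchy_prod (R : comNzRingType) (P Q : nat -> mpoly n.+1 R) k :
  muni (cauchy_prod P Q k) =
  cauchy_prod (fun i => muni (P i)) (fun i => muni (Q i)) k.
Proof. by rewrite raddf_sum; apply: eq_bigr => i _; rewrite /= muniM. Qed.

(** The lowest nonzero part of P divides the scalar b, hence is itself a nonzero scalar; being
    homogeneous of degree i, it forces i = 0. *)
Lemma cauchy_sqr_const_neq0 (R : numFieldType) (P Q : nat -> mpoly n.+1 R)
    (H : nat -> mpoly n R) b :
  (forall k, P k \is ishomog1 k mdeg) -> (0 < b)%N -> (exists k, H k != 0) ->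
  cauchy_prod P (cauchy_prod P Q) =1
    (fun k => mwiden (H k) +
      (if k == b then mpolyX R (mnm1 ord_max) ^+ b else 0)) ->
  mcoeff mnm0 (P 0%N) != 0.
Proof.
move=> Phom b_gt0 H0 PPQ.
have bR : b%:R != 0 :> R by rewrite pnatr_eq0 -lt0n.
have bB : b%:R != 0 :> mpoly n R by rewrite -mpolyC_nat mpolyC_eq0.
have [|i [w [iP Piw]]] := @cauchy_sqr_lead_unit _ (fun i => muni (P i))
  (fun i => muni (Q i)) H b b_gt0 bB H0.
  move=> k; transitivity (muni (cauchy_prod P (cauchy_prod P Q) k)).
    rewrite muni_cauchy_prod; apply: eq_bigr => j _.
    by rewrite muni_cauchy_prod.
  rewrite PPQ muniD muni_mwiden; congr (_ + _).
  by case: ifP; rewrite ?muni0 ?muniXn.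
have : muni (P i) * w \is a GRing.unit.
  rewrite Piw poly_unitE size_polyC bB coefC /=.
  by rewrite -mpolyC_nat; apply: rmorph_unit; rewrite unitfE.
rewrite unitrM => /andP[+ _]; rewrite poly_unitE => /andP[/eqP size1].
move=> /andP[/eqP Pi00].
set c := mcoeff _ _ in Pi00 *; rewrite unitfE => c0.
have Pi : P i = mpolyC _ c.
  by apply: muni_inj; rewrite muniC -Pi00 -size1_polyC ?size1.
suff i0 : i = 0%N by rewrite -i0 Pi mcoeffC eqxx mulr1.
apply: (dhomog_uniq (p := P i) _ (Phom i)); first by rewrite Pi mpolyC_eq0.
rewrite Pi -[mpolyC _ c]mulr1 mul_mpolyC; apply: dhomogZ.
exact: dhomog1.
Qed.
End LastVariable.

(** In characteristic 0 the naturals below [size p] are distinct, one too many to be all roots. *)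
Lemma poly_neq0_horner (R : numDomainType) (p : {poly R}) : p != 0 ->
  exists t, p.[t] != 0.
Proof.
move=> p0; have : ~~ all (root p) [seq i%:R | i <- iota 0 (size p)].
  apply/negP => /(max_poly_roots p0); rewrite size_map size_iota ltnn.
  by rewrite map_inj_uniq ?iota_uniq => [/(_ isT) //|]; apply: mulrIn; rewrite oner_eq0.
by case/allPn => t _ pt; exists t.
Qed.

Lemma mpoly_neq0_meval (R : numDomainType) n (p : mpoly n R) : p != 0 ->
  exists x, meval x p != 0.
Proof.
elim: n p => [|n IH] p p0.
  exists (fun=> 0); rewrite (nvar0_mpolyC p) mevalC.
  by apply: contraNneq p0 => p00; rewrite (nvar0_mpolyC p) p00 mpolyC0.
have q0 : muni p != 0.
  by apply: contraNneq p0 => mp; apply/eqP/muni_inj; rewrite mp muni0.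
(* Where the leading coefficient in the last variable is nonzero, specializing the other variables
   leaves a nonzero polynomial in one variable. *)
have [x lx] := IH (lead_coef (muni p)) ltac:(by rewrite lead_coef_eq0).
have [|t pt] := @poly_neq0_horner _ (map_poly (meval x) (muni p)).
  apply: contraNneq lx => /(congr1 (fun q : {poly R} => q`_(size (muni p)).-1)).
  by rewrite coef_map coef0 lead_coefE => /= ->.
exists (fun i => if unlift ord_max i is Some j then x j else t).
rewrite meval_muni unlift_none.
rewrite (_ : map_poly _ _ = map_poly (meval x) (muni p)) //.
by apply: eq_map_poly => q; apply: meval_eq => i; rewrite widen_lift liftK.
Qed.

(** * Relative multiplicities *)

Section Multivariate.
Context {K : numClosedFieldType} {n : nat}.
Implicit Types (p q h : mpoly n K).

Lemma mpoly_unitE p : (p \is a GRing.unit) = (msize p == 1%N).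
Proof.
apply/idP/msize_poly1P => [/andP[/eqP pE p0]|[c c0 ->]].
  by exists (mcoeff mnm0 p); rewrite // -unitfE.
by apply/andP; rewrite mcoeffC eqxx mulr1 unitfE.
Qed.

Lemma msize_homog k p : p != 0 -> p \is ishomog1 k mdeg -> msize p = k.+1.
Proof. by move=> p0 /dhomogP pk; rewrite -mlead_deg // pk ?mlead_supp. Qed.

Lemma irreducible_msize h : irreducible_mpoly h -> (1 < msize h)%N.
Proof.
move=> [/eqP h0 hu _]; rewrite ltn_neqAle eq_sym -mpoly_unitE hu /=.
by rewrite lt0n mmeasure_poly_eq0.
Qed.

(** Each occurrence of an irreducible factor uses up at least one degree, and [msize] is the degree
    plus one. *)
Lemma irreducible_factorization_le p r (h : 'I_r -> mpoly n K) e i :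
  p != 0 -> irreducible_factorization p h e -> (e i < msize p)%N.
Proof.
move=> + [irr _ _ pE]; rewrite {}pE (bigD1 i) //=.
set q := \prod_(_ < _ | _) _ => hq0.
have h1 := irreducible_msize (irr i).
elim: (e i) hq0 => [|k IH]; first by rewrite lt0n mmeasure_poly_eq0.
rewrite exprS -mulrA mulf_eq0 negb_or => /andP[h0 hq0].
rewrite msizeM // -ltnS prednK; last by rewrite addn_gt0 (ltnW h1).
exact: (leq_add h1 (IH hq0)).
Qed.

Lemma relative_multiplicity_le (f : 'rV[K]_n -> K) X d :
  initial_form f != 0 -> initial_form f \is ishomog1 d mdeg ->
  (relative_multiplicity f X <= d)%N.
Proof.
move=> f0 fd; rewrite /relative_multiplicity.
(* When no factorization exhibits X, the value is the default 0, which also satisfies the bound. *)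
case: xgetP => [k -> [r [h [e [i [fac _ ->]]]]]|_ //].
by rewrite -ltnS -(msize_homog f0 fd); exact: irreducible_factorization_le fac.
Qed.

Lemma irreducible_mpolyX i : irreducible_mpoly (mpolyX K (@mnm1 n i)).
Proof.
have X0 : mpolyX K (mnm1 i) != 0.
  by rewrite -(mmeasure_poly_eq0 mdeg) msizeX.
split; [exact/eqP | by rewrite mpoly_unitE msizeX /= mdeg1|].
move=> a b ab; have := X0; rewrite ab mulf_eq0 negb_or => /andP[a0 b0].
have := msizeM a0 b0; rewrite -ab msizeX /= mdeg1 !mpoly_unitE.
have := a0; have := b0; rewrite -!(mmeasure_poly_eq0 mdeg).
case: (msize a) => [//|[|ka]]; first by left.
case: (msize b) => [//|[|kb]]; first by right.
by rewrite !addnS !addSn.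
Qed.

End Multivariate.

(** * The hyperplane z = 0 and the factorizations of z^b *)

Section Hyperplane.
Context {K : numClosedFieldType} {n : nat}.
Local Notation X := (mpolyX K (@mnm1 n.+1 ord_max)).

Definition last_hyperplane : set 'rV[K]_n.+1 := [set x | x 0 ord_max = 0].

Lemma zero_locus_lastX b : (0 < b)%N -> zero_locus (X ^+ b) = last_hyperplane.
Proof.
move=> b0; apply/seteqP; split => x /=; rewrite /zero_locus /last_hyperplane /=
  /eval_at rmorphXn /= mevalXU; last by move->; rewrite expr0n gtn_eqF.
by move/eqP; rewrite expf_eq0 b0 => /eqP.
Qed.

Lemma last_hyperplane_linear : linear_subspace last_hyperplane.
Proof.
pose c : 'cV[K]_n.+1 := delta_mx ord_max 0.
exists (lker (linfun (mulmxr c : 'rV[K]_n.+1 -> 'rV[K]_1))).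
apply/seteqP; split => x /=; rewrite memv_ker lfunE /= /last_hyperplane /=.
  move=> x0; apply/eqP/rowP => i; rewrite mxE (bigD1 ord_max) //= x0 mul0r.
  rewrite big1 ?addr0 ?mxE // => j jm; rewrite mxE (negbTE jm) /= mulr0 //.
move=> /eqP/rowP/(_ 0); rewrite !mxE (bigD1 ord_max) //= mxE !eqxx mulr1.
by rewrite big1 ?addr0 // => j jm; rewrite mxE (negbTE jm) /= mulr0.
Qed.

Lemma last_hyperplane_algebraic : algebraic_set last_hyperplane.
Proof.
by exists [set X]; rewrite bigcap_set1 -[X]expr1 zero_locus_lastX.
Qed.

Lemma eval_at_line (x y : 'rV[K]_n.+1) (p : mpoly n.+1 K) :
  exists q : {poly K}, forall t, q.[t] = eval_at (x + t *: (y - x)) p.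
Proof.
exists (mmap polyC (fun i => (x 0 i)%:P + (y 0 i - x 0 i) *: 'X) p) => t.
rewrite /eval_at mevalE /mmap horner_sum; apply: eq_bigr => m _.
rewrite hornerM hornerC; congr (_ * _); rewrite /mmap1 horner_prod.
apply: eq_bigr => i _; rewrite horner_exp hornerD hornerC hornerZ hornerX.
by rewrite !mxE mulrC.
Qed.

(* Two polynomials that do not vanish at points x, y of the hyperplane have a
   common point of the line xy where neither vanishes. *)
Lemma last_hyperplane_irreducible : irreducible_algebraic_set last_hyperplane.
Proof.
split; first exact: last_hyperplane_algebraic.
  by exists 0; rewrite /last_hyperplane /= mxE.
move=> B1 B2 [I1 B1E] [I2 B2E] HE.
apply: contrapT => /not_orP[H1 H2].
have ex B I (BE : B = \bigcap_(p in I) zero_locus p) :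
    B `<=` last_hyperplane -> last_hyperplane <> B ->
    exists x p, [/\ last_hyperplane x, I p & eval_at x p != 0].
  move=> sB HB; apply: contrapT => nex; apply: HB; apply/seteqP; split => // x Hx.
  rewrite BE => p Ip; apply: contrapT => xp; apply: nex.
  by exists x, p; split => //; apply/eqP.
have [x [p [Hx I1p xp]]] := ex _ _ B1E (fun z Bz => eq_ind_r (fun A => A z) (or_introl Bz) HE) H1.
have [y [q [Hy I2q yq]]] := ex _ _ B2E (fun z Bz => eq_ind_r (fun A => A z) (or_intror Bz) HE) H2.
have [p' p'E] := eval_at_line x y p.
have [q' q'E] := eval_at_line x y q.
have p'0 : p' != 0.
  apply: contraNneq xp => p'0; have := p'E 0; rewrite p'0 horner0 scale0r addr0.
  by move=> <-.
have q'0 : q' != 0.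
  apply: contraNneq yq => q'0; have := q'E 1; rewrite q'0 horner0 scale1r.
  by rewrite addrC subrK => <-.
have [t] := @poly_neq0_horner _ (p' * q') (mulf_neq0 p'0 q'0).
rewrite hornerM p'E q'E mulf_eq0 negb_or => /andP[/eqP tp /eqP tq].
set z := x + _ in tp tq.
have : last_hyperplane z.
  move: Hx Hy; rewrite /last_hyperplane /= => Hx Hy.
  by rewrite !mxE Hx Hy subr0 mulr0 addr0.
by rewrite HE B1E B2E => -[/(_ p I1p)|/(_ q I2q)].
Qed.

Lemma components_last_hyperplane :
  irreducible_components last_hyperplane last_hyperplane.
Proof.
split => //; first exact: last_hyperplane_irreducible.
by move=> Z _ HZ ZH; apply/seteqP.
Qed.

Lemma lastX_dvd (p : mpoly n.+1 K) : (muni p)`_0 = 0 -> exists q, p = X * q.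
Proof.
(* Lower the exponent of z by one in every monomial. The truncated subtraction [mnm_sub] is exact
   here, because p has no monomial free of z. *)
move=> p0; exists (\sum_(m <- msupp p)
  mcoeff m p *: mpolyX K (mnm_sub m (mnm1 ord_max))).
rewrite {1}(mpolyE p) big_distrr big_seq [RHS]big_seq; apply: eq_bigr => m mp.
rewrite /= -scalerAr -mpolyXD addmC submK // lep1mP.
move: mp; rewrite mcoeff_msupp; apply: contraNneq => m0.
suff -> : m = mnm_rcons (Multinom [tuple m (widen_ord (leqnSn n) i) | i < n]) 0.
  by rewrite -coef_muni p0 mcoeff0.
by apply/eqP; rewrite mnm_rconsP eqxx m0 eqxx.
Qed.

(** The part free of z lives in the domain K[x], so z divides h or w. In the first case
    irreducibility of h makes the cofactor a unit; in the second, z cancels and b drops by one. *)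
Lemma irreducible_dvd_lastXn h w b : irreducible_mpoly h -> h * w = X ^+ b ->
  associate_mpoly h X.
Proof.
move=> [h0 hu hirr]; elim: b w => [|b IH] w hw.
  have : h * w \is a GRing.unit by rewrite hw expr0 unitr1.
  by rewrite unitrM (negbTE hu).
have /eqP : ((muni h)`_0 * (muni w)`_0 : mpoly n K) = 0.
  by rewrite -coef0M -muniM hw muniXn coefXn.
rewrite (@mulf_eq0 (mpoly n K)) => /orP[/eqP/lastX_dvd[q hE]|/eqP/lastX_dvd[w' wE]].
  exists q; last by rewrite mulrC.
  case: (hirr _ _ hE) => //.
  by have [_ /negP] := @irreducible_mpolyX K n.+1 ord_max.
apply: (IH w'); have [/eqP X0 _ _] := @irreducible_mpolyX K n.+1 ord_max.
by apply: (mulfI X0); rewrite mulrCA -wE hw exprS.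
Qed.

(** All irreducible factors of z^b are associate to z, hence there is only one of them, and degrees
    determine its exponent. *)
Lemma relative_multiplicity_lastXn (f : 'rV[K]_n.+1 -> K) b : (0 < b)%N ->
  initial_form f = X ^+ b -> relative_multiplicity f last_hyperplane = b.
Proof.
move=> b0 fE; rewrite /relative_multiplicity; case: xgetP => [k -> |/(_ b)[]].
  move=> [r [h [e [i [fac _ ->]]]]]; have [irr nas e0] := fac.
  rewrite fE => XE.
  have ass j : associate_mpoly (h j) X.
    apply: (irreducible_dvd_lastXn (irr j)
      (w := h j ^+ (e j).-1 * \prod_(l < r | l != j) h l ^+ e l) (b := b)).
    by rewrite XE [RHS](bigD1 j) //= mulrA -exprS prednK.
  have [u uu hi] := ass i.
  move: XE; rewrite (bigD1 i) //= big1 ?mulr1; last first.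
    move=> j ji; case: (nas _ _ ji).
    have [v vu hj] := ass j; exists (v * u^-1); first by rewrite unitrM unitrV vu.
    by rewrite hi mulrA divrK.
  rewrite hi exprMn mpolyXn mpolyXn => /(congr1 (fun p => msize p)).
  have u1 : msize (u ^+ e i) = 1%N.
    by apply/eqP; rewrite -mpoly_unitE unitrX.
  rewrite msizeM ?u1 ?msizeX /= ?mdegMn ?mdeg1 ?mul1n => [[->]//||].
    by rewrite -(mmeasure_poly_eq0 mdeg) u1.
  by rewrite -(mmeasure_poly_eq0 mdeg) msizeX.
(* This excludes the default of [xget]: z^b, with the single factor z, is an irreducible
   factorization. *)
exists 1%N, (fun=> X), (fun=> b), 0; split => //; last first.
  by rewrite -[X]expr1 zero_locus_lastX.
split => //; first by move=> _; exact: irreducible_mpolyX.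
  by move=> i j; rewrite !ord1 eqxx.
by rewrite big_ord1.
Qed.

End Hyperplane.

(** * Convergent power series *)

Section CoefNorm.
Context {K : numClosedFieldType} {n : nat}.
Implicit Types (p q : mpoly n K) (x : 'rV[K]_n).

(** The l1 norm of the coefficients. It is submultiplicative, and it gives the value of
    [abs_eval_at] at the diagonal points of a polydisc. *)
Definition coef_norm p : K := \sum_(a <- msupp p) `|mcoeff a p|.

Lemma coef_norm_ge0 p : 0 <= coef_norm p.
Proof. exact: sumr_ge0. Qed.

(** Supports vary with the polynomial; a common finite index set allows termwise comparison. *)
Lemma coef_normwE k p : (msize p <= k)%N ->
  coef_norm p = \sum_(m : bmultinom n k) `|mcoeff m p|.
Proof.
move=> pk; pose I : subFinType _ := bmultinom n k.
rewrite /coef_norm (ssrcomplements.big_mksub I) //=; first last.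
- by move=> m /msize_mdeg_lt /leq_trans; apply.
- by rewrite msupp_uniq.
by rewrite big_rmcond //= => i; move/memN_msupp_eq0 ->; rewrite normr0.
Qed.

Lemma coef_norm0 : coef_norm 0 = 0.
Proof. by rewrite /coef_norm msupp0 big_nil. Qed.

Lemma coef_normD p q : coef_norm (p + q) <= coef_norm p + coef_norm q.
Proof.
pose k := maxn (msize (p + q)) (maxn (msize p) (msize q)).
have [pqk pk qk] : [/\ msize (p + q) <= k, msize p <= k & msize q <= k]%N.
  by rewrite /k !leq_max !leqnn !orbT.
rewrite !(@coef_normwE k) // -big_split; apply: ler_sum => m _.
by rewrite mcoeffD ler_normD.
Qed.

Lemma coef_norm_sum I (r : seq I) (P : pred I) (F : I -> mpoly n K) :
  coef_norm (\sum_(i <- r | P i) F i) <= \sum_(i <- r | P i) coef_norm (F i).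
Proof.
elim/big_ind2: _ => [|a b c d ab cd|//]; first by rewrite coef_norm0.
exact: le_trans (coef_normD _ _) (lerD ab cd).
Qed.

Lemma coef_normZX c m : coef_norm (c *: mpolyX K m) = `|c|.
Proof.
rewrite (@coef_normwE (msize (c *: mpolyX K m) + (mdeg m).+1)) ?leq_addr //.
have mk : (mdeg m < msize (c *: mpolyX K m) + (mdeg m).+1)%N by rewrite ltn_addl.
rewrite (bigD1 (BMultinom mk)) //= mcoeffZ mcoeffX eqxx mulr1 big1 ?addr0 // => i.
by rewrite bmeqP /= mcoeffZ mcoeffX eq_sym => /negbTE ->; rewrite mulr0 normr0.
Qed.

Lemma coef_normC c : coef_norm (mpolyC n c) = `|c|.
Proof. by rewrite -[mpolyC _ _]mulr1 mul_mpolyC -mpolyX0 coef_normZX. Qed.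

Lemma coef_normM p q : coef_norm (p * q) <= coef_norm p * coef_norm q.
Proof.
rewrite [in leLHS](mpolyE p) [in leLHS](mpolyE q) big_distrlr /=.
apply: (le_trans (coef_norm_sum _ _ _)).
rewrite /coef_norm big_distrlr /=; apply: ler_sum => m1 _.
apply: (le_trans (coef_norm_sum _ _ _)); apply: ler_sum => m2 _.
by rewrite -scalerAl -scalerAr scalerA -mpolyXD coef_normZX normrM.
Qed.

Lemma abs_eval_ge0 x p : 0 <= abs_eval_at x p.
Proof. exact: sumr_ge0. Qed.

Lemma eval_at_le x p : `|eval_at x p| <= abs_eval_at x p.
Proof. by rewrite /eval_at mevalE; exact: ler_norm_sum. Qed.

Lemma abs_eval_le x p k d : p \is ishomog1 k mdeg -> (forall i, `|x 0 i| <= d) ->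
  abs_eval_at x p <= coef_norm p * d ^+ k.
Proof.
move=> /dhomogP pk xd; rewrite /coef_norm /abs_eval_at big_distrl /= big_seq [leRHS]big_seq.
apply: ler_sum => m /pk <-; rewrite normrM ler_wpM2l // normr_prod /= mdegE.
rewrite -prodrXr; apply: ler_prod => i _; rewrite normr_ge0 normrX.
by rewrite lerXn2r // nnegrE ?normr_ge0 // (le_trans (normr_ge0 _) (xd i)).
Qed.

Lemma abs_eval_const p k d : p \is ishomog1 k mdeg -> 0 <= d ->
  abs_eval_at (const_mx d) p = coef_norm p * d ^+ k.
Proof.
move=> /dhomogP pk d0; rewrite /coef_norm big_distrl /= /abs_eval_at.
rewrite big_seq [RHS]big_seq; apply: eq_bigr => m /pk /= <-.
rewrite normrM; congr (_ * _).
under eq_bigr do rewrite mxE.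
by rewrite prodrXr normrX ger0_norm // mdegE.
Qed.

Lemma eval_at_scale x p k s : p \is ishomog1 k mdeg ->
  eval_at (s *: x) p = s ^+ k * eval_at x p.
Proof.
move=> /dhomogP pk; rewrite /eval_at !mevalE big_distrr /= big_seq [RHS]big_seq.
apply: eq_bigr => m /pk /= <-; rewrite mulrCA; congr (_ * _).
under eq_bigr do rewrite mxE exprMn.
by rewrite big_split /= prodrXr mdegE.
Qed.

Lemma eval_at_cauchy x (P Q : nat -> mpoly n K) k :
  eval_at x (cauchy_prod P Q k) =
  cauchy_prod (fun i => eval_at x (P i)) (fun i => eval_at x (Q i)) k.
Proof. by rewrite /eval_at raddf_sum; apply: eq_bigr => i _; rewrite /= mevalM. Qed.

Lemma cauchy_prod_homog (P Q : nat -> mpoly n K) k :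
  (forall k, P k \is ishomog1 k mdeg) -> (forall k, Q k \is ishomog1 k mdeg) ->
  cauchy_prod P Q k \is ishomog1 k mdeg.
Proof.
move=> Ph Qh; apply: rpred_sum => i _.
have ik : (i + (k - i))%N = k by rewrite subnKC // -ltnS.
by have := dhomogM (Ph i) (Qh (k - i)%N); rewrite ik.
Qed.

(** Convergence near 0, expressed on coefficients alone: this form is stable under sums, Cauchy
    products and reciprocals. *)
Definition geometric_bound (P : nat -> mpoly n K) : Prop :=
  exists C r, [/\ 0 <= C, 0 < r & forall k, coef_norm (P k) <= C * r ^+ k].

Lemma geometric_boundD P Q : geometric_bound P -> geometric_bound Q ->
  geometric_bound (fun k => P k + Q k).
Proof.
move=> [C [r [C0 r0 PC]]] [D [s [D0 s0 QD]]].
exists (C + D), (r + s); split; [exact: addr_ge0|exact: addr_gt0|] => k.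
apply: (le_trans (coef_normD _ _)); rewrite mulrDl.
apply: lerD; [apply: le_trans (PC k) _|apply: le_trans (QD k) _];
  apply: ler_wpM2l => //; apply: lerXn2r; rewrite ?nnegrE ?addr_ge0 ?ltW //.
- by rewrite ltrDl.
- by rewrite ltrDr.
Qed.

Lemma geometric_boundM P Q : geometric_bound P -> geometric_bound Q ->
  geometric_bound (cauchy_prod P Q).
Proof.
move=> [C [r [C0 r0 PC]]] [D [s [D0 s0 QD]]]; set t := r + s.
have rt : r <= t by rewrite lerDl ltW.
have st : s <= t by rewrite lerDr ltW.
have t0 : 0 < t by rewrite addr_gt0.
have rtX j : r ^+ j <= t ^+ j by apply: lerXn2r => //; rewrite nnegrE ltW.
have stX j : s ^+ j <= t ^+ j by apply: lerXn2r => //; rewrite nnegrE ltW.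
(* The factor 2^k absorbs the k+1 terms of the Cauchy product. *)
exists (C * D), (2 * t); split; [exact: mulr_ge0|by rewrite mulr_gt0|] => k.
apply: (le_trans (coef_norm_sum _ _ _)).
apply: (@le_trans _ _ (\sum_(i < k.+1) C * D * t ^+ k)).
  apply: ler_sum => i _; apply: (le_trans (coef_normM _ _)).
  have -> : t ^+ k = t ^+ i * t ^+ (k - i) by rewrite -exprD subnKC // -ltnS.
  rewrite mulrACA; apply: ler_pM; rewrite ?coef_norm_ge0 //.
    by apply: le_trans (PC i) _; rewrite ler_wpM2l // rtX.
  by apply: le_trans (QD _) _; rewrite ler_wpM2l // stX.
rewrite sumr_const card_ord -[leLHS]mulr_natl mulrCA ler_wpM2l ?mulr_ge0 //.
rewrite exprMn ler_wpM2r ?exprn_ge0 ?(ltW t0) //.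
by rewrite -natrX ler_nat ltn_expl.
Qed.

End CoefNorm.

Lemma coef_norm_mwiden {K : numClosedFieldType} {n} (p : mpoly n K) :
  coef_norm (mwiden p) <= coef_norm p.
Proof.
rewrite [in leLHS](mpolyE p) raddf_sum /=; apply: (le_trans (coef_norm_sum _ _ _)).
by apply: ler_sum => m _; rewrite mwidenZ mwidenX coef_normZX.
Qed.

Lemma geometric_bound_mwiden {K : numClosedFieldType} {n} (P : nat -> mpoly n K) :
  geometric_bound P -> geometric_bound (fun k => mwiden (P k)).
Proof.
move=> [C [r [C0 r0 PC]]]; exists C, r; split => // k.
exact: le_trans (coef_norm_mwiden _) (PC k).
Qed.

Lemma geometric_bound_single {K : numClosedFieldType} {n} b (q : mpoly n K) :
  geometric_bound (fun k => if k == b then q else 0).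
Proof.
exists (coef_norm q), 1; split; rewrite ?coef_norm_ge0 // => k.
by rewrite expr1n mulr1; case: ifP => // _; rewrite coef_norm0 coef_norm_ge0.
Qed.

(** An abstract [K] need not be complete; this comparison test is what the proof takes from the
    completeness of the complex numbers. *)
Definition dominated_series_cvg (K : numClosedFieldType) : Prop :=
  forall (u : nat -> K) (C t : K), 0 <= t < 1 ->
    (forall k, 0 <= u k <= C * t ^+ k) -> cvgn (series u).

Section Series.
Context {K : numClosedFieldType}.
Implicit Types (a b u : nat -> K).

Lemma near0_row n (d : K) : 0 < d ->
  \forall x \near (0 : 'rV[K]_n), forall i, `|(x : 'rV[K]_n) 0 i| < d.
Proof.
move=> d0; apply/nbhs_ballP; exists d => // x [_ xd] i.
by have := xd 0 i; rewrite /ball /= mxE sub0r normrN.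
Qed.

Lemma near0_row_ex n (P : set 'rV[K]_n) : (\forall x \near (0 : 'rV[K]_n), P x) ->
  exists2 d : K, 0 < d & forall x : 'rV[K]_n, (forall i, `|x 0 i| < d) -> P x.
Proof.
move=> /nbhs_ballP[d d0 dP]; exists d => // x xd; apply: dP; split => // i j.
by rewrite /ball /= mxE sub0r normrN ord1.
Qed.

Lemma cvg0_seqP u : u @ \oo --> (0 : K) <->
  forall e, 0 < e -> exists M, forall N, (M <= N)%N -> `|u N| < e.
Proof.
split=> [/cvgr0Pnorm_lt u0 e /u0[M _ MP]|uP]; first by exists M.
by apply/cvgr0Pnorm_lt => e /uP[M MP]; exists M.
Qed.

Lemma geometric_tail (t : K) m d : 0 <= t <= 2^-1 ->
  \sum_(i < d) t ^+ (m + i) <= 2 * t ^+ m.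
Proof.
move=> /andP[t0 t2].
have -> : \sum_(i < d) t ^+ (m + i) = t ^+ m * \sum_(i < d) t ^+ i.
  by rewrite big_distrr; apply: eq_bigr => i _; rewrite exprD.
rewrite mulrC ler_wpM2r ?exprn_ge0 //.
elim: d => [|d IH]; first by rewrite big_ord0.
rewrite big_ord_recl expr0.
rewrite (_ : \sum_(_ < _) _ = t * \sum_(i < d) t ^+ i); last first.
  by rewrite big_distrr; apply: eq_bigr => i _; rewrite /= -exprS.
(* The bound 2 is the fixed point of s |-> 1 + s / 2, which dominates the recursion of the partial
   sums. *)
have -> : 2 = 1 + 2^-1 * 2 :> K by rewrite mulVf ?pnatr_eq0.
by rewrite lerD2l ler_pM // sumr_ge0 // => i _; rewrite exprn_ge0.
Qed.

Lemma cauchy_prod_series a b N : series (cauchy_prod a b) N =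
  \sum_(i < N) a i * series b (N - i)%N.
Proof.
elim: N => [|N IH]; first by rewrite /series /= big_geq // big_ord0.
rewrite [LHS]seriesSr IH [RHS](eq_bigr (fun i : 'I_N.+1 =>
  a i * series b (N - i)%N + a i * b (N - i)%N)); last first.
  by move=> i _; rewrite subSn ?seriesSr ?mulrDr // -ltnS.
by rewrite big_split /= big_ord_recr /= subnn [series b 0]big_geq // mulr0 addr0.
Qed.

Lemma series_addB b m d :
  series b (m + d)%N - series b m = \sum_(j < d) b (m + j)%N.
Proof.
rewrite sub_series_geq ?leq_addr // -{1}[m]add0n big_addn addKn big_mkord.
by apply: eq_bigr => j _; rewrite addnC.
Qed.

(** The difference collects the a_i b_j with i, j < N and i + j >= N. Each i contributes at most 2
    C^2 4^-N, and the N values of i are paid for by N <= 2^N; the ratio 1/4 is chosen so that 2^-N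
    remains. *)
Lemma cauchy_prod_series_bound a b C N :
  (forall k, `|a k| <= C * 4^-1 ^+ k) -> (forall k, `|b k| <= C * 4^-1 ^+ k) ->
  `|series a N * series b N - series (cauchy_prod a b) N| <=
    2 * C ^+ 2 * 2^-1 ^+ N.
Proof.
move=> aC bC.
have C0 : 0 <= C by have := aC 0%N; rewrite expr0 mulr1; exact: le_trans.
have q0 : 0 <= 4^-1 :> K by rewrite invr_ge0.
have q2 : 0 <= (4^-1 : K) <= 2^-1 by rewrite q0 lef_pV2 ?posrE // ler_nat.
rewrite cauchy_prod_series [series a N]big_mkord big_distrl -sumrB /=.
apply: (le_trans (ler_norm_sum _ _ _)).
apply: (@le_trans _ _ (\sum_(i < N) 2 * C ^+ 2 * 4^-1 ^+ N)).
  apply: ler_sum => i _; rewrite -mulrBr normrM.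
  have -> : 4^-1 ^+ N = 4^-1 ^+ i * 4^-1 ^+ (N - i)%N :> K.
    by rewrite -exprD subnKC // ltnW.
  have -> : 2 * C ^+ 2 * (4^-1 ^+ i * 4^-1 ^+ (N - i)%N) =
     (C * 4^-1 ^+ i) * (C * (2 * 4^-1 ^+ (N - i)%N)) by rewrite expr2; ring.
  apply: ler_pM => //.
  have -> : series b N - series b (N - i)%N = \sum_(j < i) b (N - i + j)%N.
    by rewrite -series_addB subnK // ltnW.
  apply: (le_trans (ler_norm_sum _ _ _)).
  apply: (@le_trans _ _ (\sum_(j < i) C * 4^-1 ^+ (N - i + j)%N)).
    by apply: ler_sum.
  by rewrite -big_distrr ler_wpM2l // geometric_tail.
rewrite sumr_const card_ord -[leLHS]mulr_natl mulrCA ler_wpM2l ?mulr_ge0 ?exprn_ge0 //.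
have -> : 4^-1 = 2^-1 * 2^-1 :> K by rewrite -invfM -natrM.
rewrite exprMn mulrA ler_piMl ?exprn_ge0 ?invr_ge0 // exprVn.
by rewrite ler_pdivrMr ?exprn_gt0 // mul1r -natrX ler_nat ltnW // ltn_expl.
Qed.

Hypothesis Kcvg : dominated_series_cvg K.

(** [K] is not assumed archimedean, so even this limit comes from [Kcvg], as that of the general
    term of a convergent series. *)
Lemma half_expn_cvg0 (D : K) : (fun N => D * 2^-1 ^+ N) @ \oo --> (0 : K).
Proof.
rewrite -[X in _ --> X](mulr0 D); apply: cvgM; first exact: cvg_cst.
apply: cvg_series_cvg_0; apply: (Kcvg (C := 1) (t := 2^-1)).
  by rewrite invr_ge0 ler0n invf_lt1 ?ltr1n.
by move=> k; rewrite mul1r lexx exprn_ge0 // invr_ge0.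
Qed.

Lemma cvg0_half_expn u D : (forall N, `|u N| <= D * 2^-1 ^+ N) -> u @ \oo --> (0 : K).
Proof.
move=> uD; apply/cvg0_seqP => e e0.
have /cvg0_seqP/(_ e e0)[M MP] := half_expn_cvg0 D.
exists M => N /MP; apply: le_lt_trans; apply: le_trans (uD N) _.
by rewrite real_ler_norm // ger0_real // (le_trans _ (uD N)).
Qed.

Lemma cvg_cauchy_prod a b C (l m : K) :
  (forall k, `|a k| <= C * 4^-1 ^+ k) -> (forall k, `|b k| <= C * 4^-1 ^+ k) ->
  series a @ \oo --> l -> series b @ \oo --> m ->
  series (cauchy_prod a b) @ \oo --> l * m.
Proof.
move=> aC bC al bm.
have -> : series (cauchy_prod a b) = (fun N => series a N * series b N -
    (series a N * series b N - series (cauchy_prod a b) N)).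
  by apply/funext => N; rewrite opprB addrC subrK.
rewrite -[l * m]subr0; apply: cvgB; first exact: cvgM.
by apply: cvg0_half_expn => N; exact: cauchy_prod_series_bound.
Qed.

(** With A_N and B_N the partial sums, A_N B_N tends to 1 and B_N is bounded, so A_N may be replaced
    by its limit: l B_N tends to 1. This gives at once that l is nonzero and that B_N converges. *)
Lemma cvg_cauchy_inv a b C (l : K) :
  (forall k, `|a k| <= C * 4^-1 ^+ k) -> (forall k, `|b k| <= C * 4^-1 ^+ k) ->
  (forall k, cauchy_prod a b k = (k == 0%N)%:R) ->
  series a @ \oo --> l -> l != 0 /\ series b @ \oo --> l^-1.
Proof.
move=> aC bC ab al.
have C0 : 0 <= C by have := aC 0%N; rewrite expr0 mulr1; exact: le_trans.
have ab1 : (fun N => series a N * series b N - 1) @ \oo --> (0 : K).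
  apply/cvg0_seqP => e e0.
  have /cvg0_seqP/(_ e e0)[M MP] := half_expn_cvg0 (2 * C ^+ 2).
  (* N must be positive for the partial sum of the series 1 to contain its only nonzero term. *)
  exists M.+1 => N MN; apply: le_lt_trans (MP N (ltnW MN)).
  have N0 : (0 < N)%N by apply: leq_trans MN.
  have := cauchy_prod_series_bound N aC bC.
  have -> : series (cauchy_prod a b) N = 1.
    by rewrite /series /= big_mkord -(prednK N0) big_ord_recl ab big1 ?addr0.
  by move=> h; apply: (le_trans h); rewrite real_ler_norm // ger0_real // !mulr_ge0
    ?exprn_ge0 // invr_ge0.
have bB N : `|series b N| <= 2 * C.
  rewrite /series /= big_mkord; apply: (le_trans (ler_norm_sum _ _ _)).
  apply: (@le_trans _ _ (\sum_(j < N) C * 4^-1 ^+ j)); first exact: ler_sum.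
  rewrite -big_distrr /= [leRHS]mulrC ler_wpM2l //.
  apply: le_trans (geometric_tail 0 N _) _; last by rewrite expr0 mulr1.
  by rewrite invr_ge0 ler0n lef_pV2 ?posrE // ler_nat.
have alb : (fun N => (series a N - l) * series b N) @ \oo --> (0 : K).
  apply/cvg0_seqP => e e0.
  have al0 : (fun N => series a N - l) @ \oo --> (0 : K) by apply/subr_cvg0.
  have d0 : 0 < e / (2 * C + 1).
    by rewrite divr_gt0 // ltr_wpDl // mulr_ge0.
  have /cvg0_seqP/(_ _ d0)[M MP] := al0; exists M => N /MP ad.
  have C1 : 0 < 2 * C + 1 by rewrite ltr_wpDl // mulr_ge0.
  rewrite normrM; apply: (@le_lt_trans _ _ (`|series a N - l| * (2 * C + 1))).
    by rewrite ler_wpM2l // (le_trans (bB N)) // lerDl.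
  by rewrite -ltr_pdivlMr.
have lb : (fun N => l * series b N - 1) @ \oo --> (0 : K).
  have -> : (fun N => l * series b N - 1) = (fun N =>
      (series a N * series b N - 1) - (series a N - l) * series b N).
    by apply/funext => N; ring.
  by rewrite -[X in _ --> X](subr0 0); exact: cvgB.
have l0 : l != 0.
  apply/eqP => l0; move: lb; rewrite l0 => /cvg0_seqP/(_ 1 ltr01)[M /(_ M)].
  by rewrite mul0r sub0r normrN normr1 ltxx => /(_ (leqnn _)).
split => //; apply/subr_cvg0.
have -> : (fun N => series b N - l^-1) = (fun N => l^-1 * (l * series b N - 1)).
  by apply/funext => N; rewrite mulrBr mulKf // mulr1.
by rewrite -[X in _ --> X](mulr0 l^-1); apply: cvgM => //; exact: cvg_cst.
Qed.

End Series.

Definition drop_last {K : numClosedFieldType} {n} (x : 'rV[K]_n.+1) : 'rV[K]_n :=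
  \row_(i < n) x 0 (widen_ord (leqnSn n) i).

Lemma eval_at_mwiden {K : numClosedFieldType} {n} (x : 'rV[K]_n.+1) (p : mpoly n K) :
  eval_at x (mwiden p) = eval_at (drop_last x) p.
Proof. by rewrite /eval_at meval_mwiden; apply: meval_eq => i; rewrite mxE. Qed.

Lemma near_drop_last {K : numClosedFieldType} {n} (Q : set 'rV[K]_n) :
  (\forall x \near (0 : 'rV[K]_n), Q x) ->
  \forall x \near (0 : 'rV[K]_n.+1), Q (drop_last x).
Proof.
move=> /near0_row_ex[d d0 dQ]; apply: filterS (near0_row _ d0) => x xd.
by apply: dQ => i; rewrite mxE.
Qed.

(** * Power series expansions of germs: bounds, operations, uniqueness *)

Section Expansion.
Context {K : numClosedFieldType}.
Hypothesis Kcvg : dominated_series_cvg K.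

(** A Cauchy estimate: at the diagonal point (d/2, ..., d/2) the k-th absolute term is exactly
    [coef_norm (P k)] times (d/2)^k, and the terms of a convergent series are bounded. *)
Lemma expansion_geometric_bound n (f : 'rV[K]_n -> K) P :
  power_series_expansion f P -> geometric_bound P.
Proof.
move=> [Phom /near0_row_ex[d d0 dP]].
have d2 : 0 < d / 2 by rewrite divr_gt0.
have [|+ _] := dP (const_mx (d / 2)).
  by move=> i; rewrite mxE ger0_norm ?ltW // gtr_pMr // invf_lt1 ?ltr1n.
move=> /cvg_series_cvg_0 u0.
have /cvg_seq_bounded/pinfty_ex_gt0[M M0 /= uM] :
    cvgn (fun k => abs_eval_at (const_mx (d / 2)) (P k)) by apply/cvg_ex; exists 0.
exists M, (d / 2)^-1; split=> [||k]; rewrite ?invr_gt0 ?(ltW M0) //.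
have := uM k I; rewrite ger0_norm ?abs_eval_ge0 // (abs_eval_const (Phom k) (ltW d2)).
by rewrite exprVn ler_pdivlMr // exprn_gt0.
Qed.

Lemma near_abs_eval_le n (P : nat -> mpoly n K) :
  (forall k, P k \is ishomog1 k mdeg) -> geometric_bound P ->
  exists2 C, 0 <= C & \forall x \near (0 : 'rV[K]_n),
    forall k, abs_eval_at x (P k) <= C * 4^-1 ^+ k.
Proof.
move=> Phom [C [r [C0 r0 PC]]]; exists C => //.
(* On this polydisc r^k is beaten down to 4^-k, the ratio required by the estimates for Cauchy
   products. *)
have d0 : 0 < (4 * r)^-1 by rewrite invr_gt0 mulr_gt0.
apply: filterS (near0_row _ d0) => x xd k.
apply: le_trans (abs_eval_le (Phom k) (fun i => ltW (xd i))) _.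
apply: le_trans (ler_wpM2r _ (PC k)) _; first by rewrite exprn_ge0 // ltW.
by rewrite -mulrA -exprMn invfM mulrCA divff ?mulr1 ?gt_eqF.
Qed.

Lemma geometric_bound_expansion n (f : 'rV[K]_n -> K) P :
  (forall k, P k \is ishomog1 k mdeg) -> geometric_bound P ->
  (\forall x \near (0 : 'rV[K]_n),
     series (fun k => eval_at x (P k)) @ \oo --> f x) ->
  power_series_expansion f P.
Proof.
move=> Phom Pg fP; split => //.
have [C _ PC] := near_abs_eval_le Phom Pg.
apply: filterS2 fP PC => x xf xC; split => //.
apply: (Kcvg (C := C) (t := 4^-1)).
  by rewrite invr_ge0 ler0n invf_lt1 ?ltr1n.
by move=> k; rewrite abs_eval_ge0 xC.
Qed.

Lemma expansion_germ_eq n (f g : 'rV[K]_n -> K) P : germ_eq f g ->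
  power_series_expansion f P -> power_series_expansion g P.
Proof.
move=> fg [Phom fP]; split => //.
by apply: filterS2 fg fP => x <-.
Qed.

Lemma expansionD n (f g : 'rV[K]_n -> K) P Q :
  power_series_expansion f P -> power_series_expansion g Q ->
  power_series_expansion (fun x => f x + g x) (fun k => P k + Q k).
Proof.
move=> fP gQ; have [Phom Pf] := fP; have [Qhom Qg] := gQ.
apply: geometric_bound_expansion.
- by move=> k; apply: dhomogD.
- exact: geometric_boundD (expansion_geometric_bound fP) (expansion_geometric_bound gQ).
- apply: filterS2 Pf Qg => x [_ xf] [_ xg].
  have -> : series (fun k => eval_at x (P k + Q k)) = (fun N =>
      series (fun k => eval_at x (P k)) N + series (fun k => eval_at x (Q k)) N).
    apply/funext => N; rewrite /series /= -big_split; apply: eq_bigr => k _.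
    by rewrite /eval_at mevalD.
  exact: cvgD.
Qed.

Lemma expansionM n (f g : 'rV[K]_n -> K) P Q :
  power_series_expansion f P -> power_series_expansion g Q ->
  power_series_expansion (fun x => f x * g x) (cauchy_prod P Q).
Proof.
move=> fP gQ; have [Phom Pf] := fP; have [Qhom Qg] := gQ.
have Pb := expansion_geometric_bound fP.
have Qb := expansion_geometric_bound gQ.
apply: geometric_bound_expansion.
- by move=> k; exact: cauchy_prod_homog.
- exact: geometric_boundM.
- have [C C0 PC] := near_abs_eval_le Phom Pb.
  have [D D0 QD] := near_abs_eval_le Qhom Qb.
  apply: filterS2 (filterI PC QD) (filterI Pf Qg) => x [xC xD] [[_ xf] [_ xg]].
  have -> : (fun k => eval_at x (cauchy_prod P Q k)) = cauchy_prod
      (fun i => eval_at x (P i)) (fun i => eval_at x (Q i)).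
    by apply/funext => k; rewrite eval_at_cauchy.
  apply: (@cvg_cauchy_prod _ Kcvg _ _ (C + D)) xf xg => k.
    apply: le_trans (eval_at_le _ _) (le_trans (xC k) _).
    by rewrite ler_wpM2r ?exprn_ge0 ?invr_ge0 // lerDl.
  apply: le_trans (eval_at_le _ _) (le_trans (xD k) _).
  by rewrite ler_wpM2r ?exprn_ge0 ?invr_ge0 // lerDr.
Qed.

Lemma expansion_mwiden n (f : 'rV[K]_n -> K) P :
  power_series_expansion f P ->
  power_series_expansion (fun x => f (drop_last x)) (fun k => mwiden (P k)).
Proof.
move=> fP; have [Phom Pf] := fP.
apply: geometric_bound_expansion.
- by move=> k; exact: mwiden_homog.
- exact/geometric_bound_mwiden/(expansion_geometric_bound fP).
- apply: filterS (near_drop_last Pf) => x [_].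
  by under eq_fun do rewrite -eval_at_mwiden.
Qed.

Lemma expansion_homog n (q : mpoly n K) b : q \is ishomog1 b mdeg ->
  power_series_expansion (fun x => eval_at x q) (fun k => if k == b then q else 0).
Proof.
move=> qb; apply: geometric_bound_expansion.
- by move=> k; case: eqP => [->//|_]; exact: rpred0.
- exact: geometric_bound_single.
- apply: filterE => x; apply/subr_cvg0/cvg0_seqP => e e0; exists b.+1 => N bN.
  rewrite /series /= big_mkord (bigD1 (Ordinal bN)) //= eqxx big1.
    by rewrite addr0 subrr normr0.
  move=> i; rewrite -val_eqE /= => /negbTE ->.
  by rewrite /eval_at meval0.
Qed.

(** Take the lowest nonzero part P_j and a point x with P_j(x) <> 0. At s x the sum is 0, so s^j
    |P_j(x)| is at most the tail, which is at most E s^(j+1); hence |P_j(x)| <= E s for all small s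
    > 0, which is absurd. *)
Lemma zero_expansion n P : power_series_expansion (fun _ : 'rV[K]_n => 0) P ->
  forall k, P k = 0.
Proof.
move=> P0 k; apply/eqP/negPn/negP => Pk.
have [{Pk}j Pj jP] := lowest_index Pk.
have [Phom P0x] := P0.
have [C [r [C0 r0 PC]]] := expansion_geometric_bound P0.
have [v vP] := mpoly_neq0_meval Pj.
pose x : 'rV[K]_n := \row_i v i.
have xP : 0 < `|eval_at x (P j)|.
  by rewrite normr_gt0 /eval_at (meval_eq (v2 := v)) // => i; rewrite mxE.
have [e e0 eP] := near0_row_ex P0x.
pose M := 1 + \sum_i `|x 0 i|.
have M0 : 0 < M by rewrite ltr_pwDl // sumr_ge0.
have xM i : `|x 0 i| <= M.
  by rewrite /M (bigD1 i) //= addrCA lerDl addr_ge0 // sumr_ge0.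
pose E := 2 * C * (r * M) ^+ j.+1.
have E0 : 0 <= E by rewrite !mulr_ge0 // exprn_ge0 // mulr_ge0 // ltW.
have small s : 0 < s -> s * (2 * M) < e -> s * (r * M) <= 2^-1 ->
    `|eval_at x (P j)| <= E * s.
  move=> s0 se sr.
  have sM i : `|(s *: x) 0 i| <= s * M.
    by rewrite mxE normrM (gtr0_norm s0) ler_wpM2l // ltW.
  have sMe i : `|(s *: x) 0 i| < e.
    apply: le_lt_trans (sM i) (le_lt_trans _ se); rewrite ler_wpM2l ?(ltW s0) //.
    by rewrite ler_peMl ?(ltW M0) // ler1n.
  have [_ /cvg0_seqP ser0] := eP _ sMe.
  have t0 : 0 <= s * (r * M) <= 2^-1.
    by rewrite sr andbT !mulr_ge0 // ltW.
  have bound d : 0 < d -> `|eval_at (s *: x) (P j)| <=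
      d + C * (2 * (s * (r * M)) ^+ j.+1).
    move=> d0; have [N NP] := ser0 _ d0.
    have := NP (j.+1 + N)%N (leq_addl _ _).
    rewrite /series /= big_mkord big_split_ord /= big_ord_recr /= big1; last first.
      by move=> i _; rewrite jP ?ltn_ord // /eval_at meval0.
    rewrite add0r => lt_d.
    rewrite -[eval_at _ _](addrK (\sum_(i < N) eval_at (s *: x) (P (j.+1 + i)%N))).
    apply: le_trans (ler_normB _ _) (lerD (ltW lt_d) _).
    apply: (le_trans (ler_norm_sum _ _ _)).
    apply: (@le_trans _ _ (\sum_(i < N) C * (s * (r * M)) ^+ (j.+1 + i)%N)).
      apply: ler_sum => i _; apply: le_trans (eval_at_le _ _) _.
      apply: le_trans (abs_eval_le (Phom _) sM) _.
      rewrite (mulrCA s r) (exprMn _ r) mulrA; apply: ler_wpM2r => //.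
      by rewrite exprn_ge0 // mulr_ge0 // ltW.
    by rewrite -big_distrr ler_wpM2l // geometric_tail.
  have : `|eval_at (s *: x) (P j)| <= C * (2 * (s * (r * M)) ^+ j.+1).
    by apply/ler_addgt0Pl => d; exact: bound.
  rewrite (eval_at_scale _ _ (Phom j)) normrM normrX (gtr0_norm s0).
  rewrite (_ : C * _ = s ^+ j * (E * s)) ?ler_pM2l ?exprn_gt0 //.
  by rewrite /E !exprMn !exprS; ring.
(* For s = 1/D the three first summands guarantee respectively that s x stays in the polydisc, that
   the tail has ratio at most 1/2, and that E s < |P_j(x)|. *)
pose D := 2 * M / e + 2 * (r * M) + E / `|eval_at x (P j)| + 1.
have t1 : 0 < 2 * M / e by rewrite divr_gt0 // mulr_gt0.
have t2 : 0 < 2 * (r * M) by rewrite !mulr_gt0.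
have t3 : 0 <= E / `|eval_at x (P j)| by rewrite divr_ge0.
have D0 : 0 < D by rewrite /D ltr_wpDl // !addr_ge0 // ltW.
have : `|eval_at x (P j)| <= E * D^-1.
  apply: small; first by rewrite invr_gt0.
    rewrite [ltLHS]mulrC ltr_pdivrMr // [ltRHS]mulrC -ltr_pdivrMr //.
    by rewrite /D -!addrA ltrDl; apply: ltr_pwDl => //; exact: addr_ge0.
  rewrite [leLHS]mulrC ler_pdivrMr // -ler_pdivrMl ?invr_gt0 // invrK.
  by rewrite /D -!addrA addrCA lerDl !addr_ge0 // ltW.
rewrite ler_pdivlMr // [leLHS]mulrC => DE.
have : E / `|eval_at x (P j)| < D.
  by rewrite /D addrAC ltrDr ltr_wpDl // addr_ge0 // ltW.
by rewrite ltr_pdivrMr // => /(le_lt_trans DE); rewrite ltxx.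
Qed.

Lemma expansion_unique n (f : 'rV[K]_n -> K) P Q :
  power_series_expansion f P -> power_series_expansion f Q -> P = Q.
Proof.
move=> fP fQ; apply/funext => k; apply/eqP; rewrite -subr_eq0; apply/eqP.
(* The opposite of an expansion is its product with the constant series -1. *)
have m1 : (-1 : mpoly n K) \is ishomog1 0 mdeg by rewrite rpredN; exact: dhomog1.
have fNQ := expansionD fP (expansionM (expansion_homog m1) fQ).
have /zero_expansion/(_ k) : power_series_expansion (fun=> 0) (fun k => P k +
    cauchy_prod (fun k => if k == 0%N then -1 else 0) Q k).
  apply: expansion_germ_eq fNQ; apply: filterE => x.
  by rewrite /eval_at mevalN meval1 mulN1r subrr.
by rewrite /cauchy_prod big_ord_recl big1 ?addr0 ?subn0 ?mulN1r // => i _;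
  rewrite mul0r.
Qed.

End Expansion.

(** * The reciprocal of a power series with nonzero constant term *)

Section Reciprocal.
Context {K : numClosedFieldType} {n : nat} (P : nat -> mpoly n K).
Let c := mcoeff mnm0 (P 0%N).

(* inv_prefix k lists the coefficients 0..k of the inverse series, which makes
   the course-of-values recursion structural. *)
Fixpoint inv_prefix (k : nat) : seq (mpoly n K) :=
  if k is k'.+1 then
    let s := inv_prefix k' in
    rcons s (- c^-1 *: \sum_(i < k'.+1) P i.+1 * s`_(k' - i))
  else [:: mpolyC n c^-1].

Definition inv_coef (k : nat) : mpoly n K := (inv_prefix k)`_k.

Lemma size_inv_prefix k : size (inv_prefix k) = k.+1.
Proof. by elim: k => //= k IH; rewrite size_rcons IH. Qed.

Lemma nth_inv_prefix k i : (i <= k)%N -> (inv_prefix k)`_i = inv_coef i.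
Proof.
elim: k => [|k IH]; first by case: i.
rewrite leq_eqVlt => /orP[/eqP -> //|ik].
by rewrite /= nth_rcons size_inv_prefix ik IH // -ltnS.
Qed.

Lemma inv_coefS k :
  inv_coef k.+1 = - c^-1 *: \sum_(i < k.+1) P i.+1 * inv_coef (k - i).
Proof.
rewrite /inv_coef /= nth_rcons size_inv_prefix ltnn eqxx; congr (_ *: _).
by apply: eq_bigr => i _; rewrite nth_inv_prefix ?leq_subr.
Qed.

Hypothesis Phom : forall k, P k \is ishomog1 k mdeg.
Hypothesis c0 : c != 0.

Lemma const_homog : P 0%N = mpolyC n c.
Proof.
apply/msize1_polyC; have [->|P0] := eqVneq (P 0%N) 0; first by rewrite msize0.
by rewrite (msize_homog P0 (Phom 0)).
Qed.

Lemma cauchy_prod_inv k : cauchy_prod P inv_coef k = (k == 0%N)%:R.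
Proof.
case: k => [|k].
  by rewrite /cauchy_prod big_ord1 const_homog /inv_coef /= -mpolyCM divff.
rewrite /cauchy_prod big_ord_recl /= subn0 inv_coefS const_homog mul_mpolyC.
by rewrite scalerA mulrN divff // scaleN1r addNr.
Qed.

Lemma inv_coef_homog k : inv_coef k \is ishomog1 k mdeg.
Proof.
elim/ltn_ind: k => -[|k] IH.
  rewrite /inv_coef /= -[mpolyC _ _]mulr1 mul_mpolyC; apply: dhomogZ.
  exact: dhomog1.
rewrite inv_coefS; apply: dhomogZ; apply: rpred_sum => i _.
have ik : (i.+1 + (k - i))%N = k.+1 by rewrite addSn subnKC // -ltnS.
have := dhomogM (Phom i.+1) (IH (k - i)%N _); rewrite ik; apply.
by rewrite ltnS leq_subr.
Qed.

Lemma inv_coef_geometric_bound : geometric_bound P -> geometric_bound inv_coef.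
Proof.
move=> [C [r [C0 r0 PC]]].
have ci : 0 < `|c^-1| by rewrite normr_gt0 invr_eq0.
(* Chosen so that s - r = C |c^-1| r: the sum bounding the next coefficient then telescopes to
   s^(k+1) - r^(k+1). *)
pose s := r * (1 + C * `|c^-1|).
have s0 : 0 < s by rewrite mulr_gt0 // ltr_pwDl // mulr_ge0.
exists `|c^-1|, s; split => //; elim/ltn_ind => -[|k] IH.
  by rewrite /inv_coef /= expr0 mulr1 coef_normC.
have -> : inv_coef k.+1 = \sum_(i < k.+1) mpolyC n (- c^-1) * (P i.+1 * inv_coef (k - i)).
  by rewrite inv_coefS scaler_sumr; apply: eq_bigr => i _; rewrite mul_mpolyC.
apply: (le_trans (coef_norm_sum _ _ _)).
apply: (@le_trans _ _ (\sum_(i < k.+1) `|c^-1| * (C * `|c^-1| * r) *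
    (s ^+ (k.+1.-1 - i)%N * r ^+ i))).
  apply: ler_sum => i _; apply: le_trans (coef_normM _ _) _.
  rewrite coef_normC normrN -mulrA ler_wpM2l //; apply: le_trans (coef_normM _ _) _.
  have -> : C * `|c^-1| * r * (s ^+ (k.+1.-1 - i)%N * r ^+ i) =
      C * r ^+ i.+1 * (`|c^-1| * s ^+ (k - i)%N) by rewrite exprS; ring.
  by apply: ler_pM; rewrite ?coef_norm_ge0 // IH // ltnS leq_subr.
rewrite -big_distrr /= -mulrA ler_wpM2l //.
have -> : C * `|c^-1| * r = s - r by rewrite /s; ring.
by rewrite -subrXX lerBlDr lerDl exprn_ge0 // ltW.
Qed.

End Reciprocal.

(** The formal reciprocal has a geometric bound, so near 0 it converges to 1/p; the same limit
    argument shows that p does not vanish there. *)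
Lemma unit_germ_const {K : numClosedFieldType} (Kcvg : dominated_series_cvg K) n
    (p : 'rV[K]_n -> K) P : power_series_expansion p P ->
  mcoeff mnm0 (P 0%N) != 0 -> unit_germ p.
Proof.
move=> pP c0; have [Phom Pp] := pP.
have Pb := expansion_geometric_bound pP.
have Vb := inv_coef_geometric_bound c0 Pb.
have Vhom := inv_coef_homog Phom.
have [C C0 PC] := near_abs_eval_le Phom Pb.
have [D D0 VD] := near_abs_eval_le Vhom Vb.
have pV : \forall x \near (0 : 'rV[K]_n), p x != 0 /\
    series (fun k => eval_at x (inv_coef P k)) @ \oo --> (p x)^-1.
  apply: filterS2 (filterI PC VD) Pp => x [xC xD] [_ xp].
  apply: (@cvg_cauchy_inv _ Kcvg _ _ (C + D)) xp => k.
  - apply: le_trans (eval_at_le _ _) (le_trans (xC k) _).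
    by rewrite ler_wpM2r ?exprn_ge0 ?invr_ge0 // lerDl.
  - apply: le_trans (eval_at_le _ _) (le_trans (xD k) _).
    by rewrite ler_wpM2r ?exprn_ge0 ?invr_ge0 // lerDr.
  - rewrite -eval_at_cauchy cauchy_prod_inv // /eval_at.
    by case: (k == 0%N); rewrite ?meval0 ?meval1.
split; first by exists P.
exists (fun x => (p x)^-1).
  exists (inv_coef P); apply: geometric_bound_expansion => //.
  by apply: filterS pV => x [].
by apply: filterS pV => x [px _]; rewrite divff.
Qed.

(** * Multiplicity and initial form read off an expansion *)

Section InitialForm.
Context {K : numClosedFieldType} {n : nat}.
Hypothesis Kcvg : dominated_series_cvg K.
Implicit Types f : 'rV[K]_n -> K.

Lemma homogeneous_part_expansion f P : power_series_expansion f P ->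
  homogeneous_part f = P.
Proof.
move=> fP; rewrite /homogeneous_part; case: xgetP => [Q _ fQ|/(_ P)[]//].
exact: expansion_unique fQ fP.
Qed.

Lemma multiplicity_expansion f P m : power_series_expansion f P ->
  P m != 0 -> (forall k, (k < m)%N -> P k = 0) -> multiplicity f = m.
Proof.
move=> fP /eqP Pm mP; rewrite /multiplicity (homogeneous_part_expansion fP).
case: xgetP => [k _ [Pk kP]|/(_ m)[]//].
by case: (ltngtP k m) => // [/mP//|/kP].
Qed.

Lemma initial_form_expansion f P m : power_series_expansion f P ->
  P m != 0 -> (forall k, (k < m)%N -> P k = 0) -> initial_form f = P m.
Proof.
move=> fP Pm mP; rewrite /initial_form (multiplicity_expansion fP Pm mP).
by rewrite (homogeneous_part_expansion fP).
Qed.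

Lemma expansion_neq0 f P : power_series_expansion f P ->
  ~ germ_eq f (fun=> 0) -> exists k, P k != 0.
Proof.
move=> [_ fP] f0; apply: contrapT => P0; apply: f0; apply: filterS fP => x [_ xf].
have P00 k : P k = 0 by apply/eqP/negPn/negP => Pk; apply: P0; exists k.
apply: (cvg_unique (@norm_hausdorff _ K) xf).
rewrite (_ : series _ = fun=> 0); first exact: cvg_cst.
apply/funext => N; apply: big1 => k _; by rewrite P00 /eval_at meval0.
Qed.

Lemma expansion_multiplicity f : reduced_germ f ->
  exists P, [/\ power_series_expansion f P, P (multiplicity f) != 0 &
    forall k, (k < multiplicity f)%N -> P k = 0].
Proof.
move=> [[P fP] _ f0 _]; exists P.
have [k /lowest_index[m Pm mP]] := expansion_neq0 fP f0.
by rewrite (multiplicity_expansion fP Pm mP).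
Qed.

End InitialForm.

(** * The suspension f(x)^2 + z^b *)

Section Suspension.
Context {K : numClosedFieldType} {n : nat}.
Local Notation X := (mpolyX K (@mnm1 n.+1 ord_max)).

Definition suspension (f : 'rV[K]_n -> K) (b : nat) (x : 'rV[K]_n.+1) : K :=
  f (drop_last x) ^+ 2 + x 0 ord_max ^+ b.

Hypothesis Kcvg : dominated_series_cvg K.

Lemma suspension_expansion f P b : power_series_expansion f P ->
  power_series_expansion (suspension f b)
    (fun k => mwiden (cauchy_prod P P k) + (if k == b then X ^+ b else 0)).
Proof.
move=> fP; have Xb : X ^+ b \is ishomog1 b mdeg.
  by rewrite mpolyXn dhomogX /= mdegMn mdeg1 mul1n.
have := expansionD Kcvg (expansion_mwiden Kcvg (expansionM Kcvg fP fP))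
  (expansion_homog Kcvg Xb).
apply: expansion_germ_eq; apply: filterE => x.
by rewrite /suspension expr2 /eval_at rmorphXn /= mevalXU.
Qed.

Lemma suspension_reduced f b : (0 < b)%N -> reduced_germ f ->
  reduced_germ (suspension f b).
Proof.
move=> b0 rf; have [P [fP Pm mP]] := expansion_multiplicity Kcvg rf.
have [_ f00 _ _] := rf; set m := multiplicity f in Pm mP.
have FS := suspension_expansion b fP.
split; first by eexists; exact: FS.
- have -> : suspension f b 0 = f 0 ^+ 2 + 0 ^+ b.
    rewrite /suspension mxE; congr (f _ ^+ 2 + _).
    by apply/rowP => i; rewrite !mxE.
  by rewrite f00 !expr0n (gtn_eqF b0) addr0.
(* The degree b part keeps its monomial z^b whatever f^2 contributes, since that contribution is
   free of z. *)
- move=> F0; have /zero_expansion/(_ b) := expansion_germ_eq F0 FS.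
  by rewrite eqxx => /eqP; rewrite (negbTE (mwiden_addXn_neq0 _ b0)).
- move=> p [[Pp pP] _ pnu _] [q [Qq qQ] FE]; apply: pnu.
  have PPQ := expansionM Kcvg pP (expansionM Kcvg pP qQ).
  have EE := expansion_unique Kcvg FS (expansion_germ_eq _ PPQ).
  apply: (unit_germ_const Kcvg pP); have [Phom _] := pP.
  apply: (@cauchy_sqr_const_neq0 _ _ _ Qq (cauchy_prod P P) b) => //.
    (* The lowest part of f^2 is the square of the initial form of f. *)
    by exists (m + m)%N; rewrite cauchy_prod_lead // mulf_neq0.
  move=> k; rewrite -EE //; apply: filterS FE => x ->.
  by rewrite expr2 mulrA.
Qed.

Lemma suspension_initial_low f b : reduced_germ f -> (2 * multiplicity f < b)%N ->
  initial_form (suspension f b) != 0 /\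
  initial_form (suspension f b) \is ishomog1 (2 * multiplicity f) mdeg.
Proof.
move=> rf; have [P [fP Pm mP]] := expansion_multiplicity Kcvg rf.
rewrite mul2n -addnn; set m := multiplicity f in Pm mP * => mb.
have PPm : cauchy_prod P P (m + m) = P m * P m by rewrite cauchy_prod_lead.
have Sm : mwiden (P m * P m) != 0.
  have : P m * P m != 0 by rewrite mulf_neq0.
  by apply: contraNneq => S0; apply/eqP/inj_mwiden; rewrite S0 mwiden0.
have [Phom _] := fP.
rewrite (initial_form_expansion Kcvg (suspension_expansion b fP) (m := (m + m)%N)).
- rewrite ltn_eqF // addr0 PPm; split => //.
  by apply: mwiden_homog; exact: dhomogM.
- by rewrite ltn_eqF // addr0 PPm.
- move=> k km; rewrite ltn_eqF ?(ltn_trans km) // addr0.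
  by rewrite (cauchy_prod_eq0 mP mP km) mwiden0.
Qed.

Lemma suspension_initial_high f b : reduced_germ f -> (b < 2 * multiplicity f)%N ->
  initial_form (suspension f b) = X ^+ b.
Proof.
move=> rf; have [P [fP Pm mP]] := expansion_multiplicity Kcvg rf.
rewrite mul2n -addnn; set m := multiplicity f in Pm mP * => bm.
rewrite (initial_form_expansion Kcvg (suspension_expansion b fP) (m := b)).
- by rewrite eqxx (cauchy_prod_eq0 mP mP bm) mwiden0 add0r.
- rewrite eqxx (cauchy_prod_eq0 mP mP bm) mwiden0 add0r mpolyXn.
  by rewrite -(mmeasure_poly_eq0 mdeg) msizeX.
- move=> k kb; rewrite ltn_eqF // addr0.
  by rewrite (cauchy_prod_eq0 mP mP (ltn_trans kb bm)) mwiden0.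
Qed.

Lemma tangent_cone_high f b : (0 < b)%N -> reduced_germ f ->
  (b < 2 * multiplicity f)%N ->
  tangent_cone (suspension f b) = last_hyperplane.
Proof.
move=> b0 rf bm; rewrite /tangent_cone suspension_initial_high //.
exact: zero_locus_lastX.
Qed.

(* The relative multiplicities of the two suspensions are b and at most
   2 m(f) < b. *)
Lemma suspension_relative_multiplicity f g b Y Z : reduced_germ f -> reduced_germ g ->
  (2 * multiplicity f < b < 2 * multiplicity g)%N ->
  irreducible_components (tangent_cone (suspension g b)) = [set Y] ->
  relative_multiplicity (suspension f b) Z <>
  relative_multiplicity (suspension g b) Y.
Proof.
move=> rf rg /andP[fb bg]; have b0 : (0 < b)%N := leq_ltn_trans (leq0n _) fb.
rewrite tangent_cone_high // => cY.
have : irreducible_components last_hyperplane (@last_hyperplane K n).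
  exact: components_last_hyperplane.
rewrite cY => /= <-.
rewrite (relative_multiplicity_lastXn b0 (suspension_initial_high rg bg)) => e.
have [F0 Fhom] := suspension_initial_low rf fb.
by have := relative_multiplicity_le Z F0 Fhom; rewrite e leqNgt fb.
Qed.

End Suspension.

(** * The homeomorphism phi x id *)

Section SuspendedHomeomorphism.
Context {K : numClosedFieldType} {n : nat}.

Definition suspend_map (phi : 'rV[K]_n -> 'rV[K]_n) (x : 'rV[K]_n.+1) : 'rV[K]_n.+1 :=
  \row_i if unlift ord_max i is Some j then phi (drop_last x) 0 j else x 0 ord_max.

Lemma suspend_map_last phi x : suspend_map phi x 0 ord_max = x 0 ord_max.
Proof. by rewrite mxE unlift_none. Qed.

Lemma drop_last_suspend_map phi x :
  drop_last (suspend_map phi x) = phi (drop_last x).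
Proof. by apply/rowP => i; rewrite !mxE widen_lift liftK. Qed.

Lemma drop_last_inj (x y : 'rV[K]_n.+1) :
  drop_last x = drop_last y -> x 0 ord_max = y 0 ord_max -> x = y.
Proof.
move=> /rowP xy xym; apply/rowP; apply: ord_widenP => // i.
by have := xy i; rewrite !mxE.
Qed.

Lemma continuous_row_at m (F : 'rV[K]_n.+1 -> 'rV[K]_m) x :
  (forall i, {for x, continuous (fun y => F y 0 i)}) -> {for x, continuous F}.
Proof.
move=> Fi A [P PF PA].
have : \forall y \near x, forall i, P 0 i (F y 0 i).
  apply: (filter_forall (nbhs_filter x)) => i.
  exact: (Fi i _ (PF 0 i)).
by apply: filterS => y Py; apply: PA => i j; rewrite ord1; exact: Py.
Qed.

Lemma continuous_drop_last : continuous (@drop_last K n).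
Proof.
move=> x; apply: continuous_row_at => i.
rewrite (_ : (fun y => _) = (fun y : 'rV[K]_n.+1 => y 0 (widen_ord (leqnSn n) i))).
  exact: coord_continuous.
by apply/funext => y; rewrite mxE.
Qed.

Lemma continuous_suspend_map phi x : {for drop_last x, continuous phi} ->
  {for x, continuous (suspend_map phi)}.
Proof.
move=> cphi; apply: continuous_row_at => i.
case: (unliftP ord_max i) => [j ->|->].
  rewrite (_ : (fun y => _) = (fun z : 'rV[K]_n => z 0 j) \o (phi \o drop_last)).
    apply: continuous_comp; last exact: coord_continuous.
    by apply: continuous_comp; first exact: continuous_drop_last.
  by apply/funext => y; rewrite mxE liftK.
rewrite (_ : (fun y => _) = (fun y : 'rV[K]_n.+1 => y 0 ord_max)).
  exact: coord_continuous.
by apply/funext => y; rewrite suspend_map_last.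
Qed.

Lemma suspend_homeomorphism phi : homeomorphism_germ phi ->
  homeomorphism_germ (suspend_map phi).
Proof.
move=> [phi0 [U [V [psi [[oU U0] [oV V0] [cphi cpsi] UV VU]]]]].
have drop0 : drop_last 0 = 0 :> 'rV[K]_n by apply/rowP => i; rewrite !mxE.
split.
  apply: drop_last_inj; first by rewrite drop_last_suspend_map drop0.
  by rewrite suspend_map_last !mxE.
have open_drop (W : set 'rV[K]_n) : open W -> open (@drop_last K n @^-1` W).
  by move=> oW; apply: open_comp => // x _; exact: continuous_drop_last.
(* On an open set relative continuity is continuity at each point, which passes to the cylinder over
   that set. *)
have within_drop (W : set 'rV[K]_n) th : open W -> {within W, continuous th} ->
    {within @drop_last K n @^-1` W, continuous (suspend_map th)}.
  move=> oW; rewrite (continuous_open_subspace _ oW) => cth.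
  rewrite (continuous_open_subspace _ (open_drop W oW)) => x.
  rewrite inE /= => Wx; apply: continuous_suspend_map; apply: cth.
  by rewrite inE.
have inv (th1 th2 : 'rV[K]_n -> 'rV[K]_n) x : th2 (th1 (drop_last x)) = drop_last x ->
    suspend_map th2 (suspend_map th1 x) = x.
  move=> th; apply: drop_last_inj; first by rewrite !drop_last_suspend_map.
  by rewrite !suspend_map_last.
exists (@drop_last K n @^-1` U), (@drop_last K n @^-1` V), (suspend_map psi).
split.
- by split; [exact: open_drop|rewrite /= drop0].
- by split; [exact: open_drop|rewrite /= drop0].
- by split; exact: within_drop.
- by move=> x /= /UV[Vx xE]; rewrite drop_last_suspend_map; split => //; exact: inv.
- by move=> x /= /VU[Ux xE]; rewrite drop_last_suspend_map; split => //; exact: inv.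
Qed.

Lemma suspension_germ_eq (f g : 'rV[K]_n -> K) phi b : germ_eq f (g \o phi) ->
  germ_eq (suspension f b) (suspension g b \o suspend_map phi).
Proof.
move=> /near_drop_last; apply: filterS => x fg /=.
by rewrite /suspension drop_last_suspend_map suspend_map_last fg.
Qed.

End SuspendedHomeomorphism.

(* Stated for an abstract K because R[i] has no direct topological instance. *)
Lemma dominated_series_cvg_real (R : realType) (K : numClosedFieldType)
    (iota : {rmorphism R -> K}) (re : K -> R) :
  {mono iota : x y / x <= y} -> {mono iota : x y / x < y} ->
  {morph iota : x / `|x|} -> (forall z, 0 <= z -> z = iota (re z)) ->
  dominated_series_cvg K.
Proof.
move=> iota_le iota_lt iota_norm reK u C t /andP[t0 t1] uC.
have C0 : 0 <= C by have /andP[u0] := uC 0%N; rewrite expr0 mulr1; exact: le_trans.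
have u0 k : 0 <= u k by case/andP: (uC k).
have uE k : u k = iota (re (u k)) by exact: reK.
(* Nonnegative elements of K are images of reals, so the comparison with a geometric series takes
   place in R, and the limit is carried back along the norm-preserving [iota]. *)
have : cvgn (series (fun k => re (u k))).
  apply: (@series_le_cvg _ _ (geometric (re C) (re t))).
  - by move=> k; rewrite -iota_le rmorph0 -uE.
  - move=> k /=; rewrite -iota_le rmorph0 rmorphM rmorphXn -!reK //.
    by rewrite mulr_ge0 ?exprn_ge0.
  - move=> k /=; rewrite -iota_le rmorphM rmorphXn -uE -!reK //.
    by case/andP: (uC k).
  - apply: is_cvg_geometric_series.
    by rewrite -iota_lt iota_norm rmorph1 -reK ?ger0_norm.
move=> /cvg_ex[l ul]; apply/cvg_ex; exists (iota l).
apply/subr_cvg0/cvg0_seqP => e e0.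
have eE : e = iota (re e) by apply/reK/ltW.
have re0 : 0 < re e by rewrite -iota_lt rmorph0 -eE.
have /cvgrPdist_lt/(_ _ re0)[M _ MP] := ul.
exists M => N /MP /=; rewrite -iota_lt -eE iota_norm rmorphB distrC.
suff -> : series u N = iota (series (fun k => re (u k)) N) by [].
by rewrite /series /= rmorph_sum; apply: eq_bigr => k _; exact: uE.
Qed.

Lemma complex_dominated_series_cvg (R : realType) : dominated_series_cvg R[i].
Proof.
apply: (@dominated_series_cvg_real R R[i] (real_complex R) (@complex.Re R)).
- exact: lecR.
- exact: ltcR.
- by move=> x; rewrite [RHS]normc_def /= expr0n /= addr0 sqrtr_sqr.
- by move=> z /ger0_real/RRe_real.
Qed.

Lemma eq_of_no_double_gap (p q : nat) : (forall b, (2 * p < b < 2 * q)%N -> False) ->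
  (forall b, (2 * q < b < 2 * p)%N -> False) -> p = q.
Proof.
have gap k l : (k < l)%N -> (2 * k < (2 * k).+1 < 2 * l)%N.
  by move=> kl; rewrite ltnSn -addn2 -mulnSr leq_mul2l kl.
by move=> pq qp; case: (ltngtP p q) => // /gap; [move/pq|move/qp].
Qed.

Theorem theorem1p3 (R : realType) :
  (* (B'_Rel) *)
  (forall (n : nat) (f g : 'rV[R[i]]_n -> R[i])
          (phi : 'rV[R[i]]_n -> 'rV[R[i]]_n),
     (0 < n)%N -> reduced_germ f -> reduced_germ g ->
     homeomorphism_germ phi -> germ_eq f (g \o phi) ->
     linear_subspace (tangent_cone f) \/ linear_subspace (tangent_cone g) ->
     exists X Y : set 'rV[R[i]]_n,
       [/\ irreducible_components (tangent_cone f) = [set X],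
           irreducible_components (tangent_cone g) = [set Y] &
           relative_multiplicity f X = relative_multiplicity g Y]) ->
  (* (A') *)
  (forall (n : nat) (f g : 'rV[R[i]]_n -> R[i])
          (phi : 'rV[R[i]]_n -> 'rV[R[i]]_n),
     (0 < n)%N -> reduced_germ f -> reduced_germ g ->
     homeomorphism_germ phi -> germ_eq f (g \o phi) ->
     multiplicity f = multiplicity g).
Proof.
move=> B n f g phi _ rf rg hphi fg.
have Kcvg := @complex_dominated_series_cvg R.
have BS b (b0 : (0 < b)%N) := B n.+1 (suspension f b) (suspension g b)
  (suspend_map phi) (ltn0Sn n) (suspension_reduced Kcvg b0 rf)
  (suspension_reduced Kcvg b0 rg) (suspend_homeomorphism hphi)
  (suspension_germ_eq b fg).
have lin (h : 'rV[R[i]]_n -> R[i]) b : (0 < b)%N -> reduced_germ h -> (b < 2 * multiplicity h)%N ->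
    linear_subspace (tangent_cone (suspension h b)).
  move=> b0 rh bh; rewrite (tangent_cone_high Kcvg b0 rh bh).
  exact: last_hyperplane_linear.
(* (B'_Rel) accepts a linear tangent cone on either side, so both orders of m(f) and m(g) are
   handled with the same phi, without passing to its inverse. *)
apply: eq_of_no_double_gap => b /[dup] bb /andP[b1 b2];
  have b0 : (0 < b)%N := leq_ltn_trans (leq0n _) b1.
- have [Y [Z [_ cZ YZ]]] := BS b b0 (or_intror (lin g b b0 rg b2)).
  exact: (suspension_relative_multiplicity Kcvg rf rg bb cZ YZ).
- have [Y [Z [cY _ YZ]]] := BS b b0 (or_introl (lin f b b0 rf b2)).
  exact: (suspension_relative_multiplicity Kcvg rg rf bb cY (esym YZ)).
Qed.
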